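(* Let $d,m\in\mathbb{N}$ with $d\ge3$, and let $1<q<(d-1)^{1/d}$. There exist a Hilbert space $H$ and $f\in\mathscr{P}^m_d(H)$ such that for every $r>0$ the set $K_r=\mathrm{Crit}(f)\cap B_H(r)$ is compact and satisfies $\limsup_{n\to\infty}\Omega_n(K_r,H)^{1/n}\le q^{-1}$, and such that $f$ does not have the Sard property on these sets: $\mu\big(f(\mathrm{Crit}(f)\cap K_r)\big)>0$ for some $r>0$. Consequently, any constant $\beta_0(d,m)>1$ with the property that for every Hilbert space $H$, every compact $K\subset H$ and every $q>\beta_0$ with $\limsup_n\Omega_n(K,H)^{1/n}\le q^{-1}$, and every $f\in\mathscr{P}^m_d(H)$, one has $\mu(f(\mathrm{Crit}(f)\cap K))=0$, must satisfy $\beta_0(d,m)\ge(d-1)^{1/d}$.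
   Context: For a Hilbert space $H$ and $d,m\in\mathbb{N}$, $\mathscr{P}^m_d(H)$ is the set of maps $f:H\to\mathbb{R}^m$ that are $C^1$ in the Fréchet sense, whose differential $Df:H\to\mathcal{L}(H,\mathbb{R}^m)$ is weakly continuous and locally Lipschitz, and such that for every finite-dimensional linear subspace $E\subset H$ the restriction $f|_E$ is a polynomial map of degree at most $d$. $B_H(r)$ is the closed ball of radius $r$ centered at $0$. The Kolmogorov $n$-width is $\Omega_n(K,H)=\inf_{\dim E=n}\sup_{u\in K}\inf_{v\in E}\|u-v\|$ over $n$-dimensional linear subspaces $E$. $\mathrm{Crit}(f)=\{x:\operatorname{rank}D_xf\le m-1\}$; $\mu$ is Lebesgue measure on $\mathbb{R}^m$. *)

(* Defs.v *)
From HB Require Import structures.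
From mathcomp Require Import all_boot all_order all_algebra.
From mathcomp Require Import all_classical all_reals all_analysis.
Set Implicit Arguments. Unset Strict Implicit. Unset Printing Implicit Defensive.
Import Order.TTheory GRing.Theory Num.Theory.
Import numFieldNormedType.Exports.
Local Open Scope classical_set_scope.
Local Open Scope ring_scope.

Record hilbertSpace (R : realType) := HilbertSpace {
  hs_type :> completeNormedModType R;
  hs_inner : hs_type -> hs_type -> R;
  hs_innerDl : forall x y z : hs_type,
      hs_inner (x + y) z = hs_inner x z + hs_inner y z;
  hs_innerZl : forall (a : R) (x y : hs_type),
      hs_inner (a *: x) y = a * hs_inner x y;
  hs_innerC : forall x y : hs_type, hs_inner x y = hs_inner y x;
  hs_normE : forall x : hs_type, `|x| ^+ 2 = hs_inner x x
}.

Section Defs.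
Context {R : realType} (H : hilbertSpace R).

Definition closed_ballH (r : R) : set H := [set x : H | `|x| <= r].

Definition weak_cvg (u : nat -> H) (x : H) : Prop :=
  forall y : H, (fun n => hs_inner (u n) y) @ \oo --> hs_inner x y.

Definition opnorm (m : nat) (L : H -> 'rV[R]_m) : R :=
  sup [set `|L v| | v in [set v : H | `|v| <= 1]].

Definition Ddist (m : nat) (f : H -> 'rV[R]_m) (x y : H) : R :=
  opnorm (fun v => 'd f x v - 'd f y v).

Definition polyclass (d m : nat) (f : H -> 'rV[R]_m) : Prop :=
  [/\
      (forall x : H, differentiable f x),
      (forall (x : H) (e : R), 0 < e ->
         exists2 del : R, 0 < del &
           forall y : H, `|y - x| < del -> Ddist f y x < e),
      (forall (u : nat -> H) (x : H), weak_cvg u x ->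
         (fun n => Ddist f (u n) x) @ \oo --> 0),
      (forall x : H, exists2 r : R, 0 < r & exists L : R,
         forall y z : H, `|y - x| < r -> `|z - x| < r ->
           Ddist f y z <= L * `|y - z|) &
      (* restriction to every finite-dimensional subspace (parametrised by a
         finite spanning family e) is polynomial of degree <= d *)
      (forall (k : nat) (e : 'I_k -> H) (j : 'I_m),
         exists c : {ffun 'I_k -> 'I_d.+1} -> R,
           forall t : 'I_k -> R,
             f (\sum_(i < k) t i *: e i) 0 j =
             \sum_(a : {ffun 'I_k -> 'I_d.+1} | (\sum_(i < k) (a i : nat) <= d)%N)
                c a * \prod_(i < k) t i ^+ a i)].

(* Crit(f) = { x | rank D_x f <= m - 1 }, the rank of a linear map L being
   the supremum of the ranks of the families (L v_1, ..., L v_k). *)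
Definition Crit (m : nat) (f : H -> 'rV[R]_m) : set H :=
  [set x : H | forall (k : nat) (v : 'I_k -> H),
     (\rank (\matrix_(i < k) ('d f x (v i) : 'rV[R]_m)) <= m.-1)%N].

Definition lin_indep (n : nat) (e : 'I_n -> H) : Prop :=
  forall c : 'I_n -> R, \sum_(i < n) c i *: e i = 0 -> forall i, c i = 0.

Definition dist_span (n : nat) (e : 'I_n -> H) (u : H) : R :=
  inf [set `|u - \sum_(i < n) c i *: e i| | c in [set: 'I_n -> R]].

(* Kolmogorov n-width: n-dimensional subspaces are spans of linearly
   independent n-families *)
Definition kolmogorov_width (n : nat) (K : set H) : \bar R :=
  ereal_inf [set ereal_sup [set (dist_span e u)%:E | u in K]
            | e in [set e : 'I_n -> H | lin_indep e]].

End Defs.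

Definition box {R : realType} (m : nat) (a b : 'rV[R]_m) : set 'rV[R]_m :=
  [set x | forall i : 'I_m, a 0 i <= x 0 i <= b 0 i].

Definition lebesgue_outer {R : realType} (m : nat) (A : set 'rV[R]_m) : \bar R :=
  ereal_inf [set (\sum_(0 <= k <oo) (\prod_(i < m) (b.2 k 0 i - b.1 k 0 i))%:E)%E
            | b in [set b : (nat -> 'rV[R]_m) * (nat -> 'rV[R]_m) |
                     (forall k i, b.1 k 0 i <= b.2 k 0 i) /\
                     A `<=` \bigcup_k box (b.1 k) (b.2 k)]].

(* Main.v *)
(** Write [D := d - 1] and let [p] be a polynomial of degree [d] whose derivative
    has [D] real roots at which the values of [p] are equally spaced.  On l2 put
    [phi x := \sum_(k >= m - 1) D ^ - k * p (q ^ k * x_k)] and let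
    [f x := (x_0, ..., x_(m-2), phi x)].  Since [q ^ d < D] the coefficients of
    the summands decay geometrically, so [f] has the required regularity.  A point
    is critical for [f] exactly when every [q ^ k * x_k] is a critical point of
    [p]; hence the bounded pieces of the critical set lie in Hilbert cubes with
    sides of order [q ^ - k], whose widths are of order [q ^ - n].  The critical
    values of [phi] are, up to an affine map, all the base [D] expansions, so they
    fill an interval and the image of the critical set contains a box.

    The polynomial [p] is the primitive of [\prod_j (c_j - X)] for well chosen
    [0 = c_0 <= ... <= c_e = 1], [e = D - 1].  Among such [c] we maximise the [t]
    for which the oscillations [`|p c_i - p c_(i+1)|] are at least [t * (i + 1)]
    times their sum.  The [D] critical values can be moved independently to first
    order, by Lagrange interpolation, so at a maximum the oscillations are exactly
    proportional to [1, 2, ..., e]; as they alternate in sign, the critical values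
    form an arithmetic progression. *)

(* The bound on [q] balances two demands. Base [D] expansions fill an interval only if the [k]-th
   summand has amplitude of order [D^-k] and [D] equally spaced critical values; on the other hand
   its coefficients are as large as [D^-k q^(kd)], and they must be summable for the map to be
   smooth on all of l2. With [e = D - 1], the assumption [d >= 3] is [e >= 1]: there are at least
   two digits.

   Consecutive oscillations have opposite signs, so equal oscillations would produce only two
   critical values. With oscillations proportional to [1, 2, ..., e] the critical values spiral
   outwards from the first one and visit each level exactly once.

   Prescribing the critical values is a nonlinear problem in the critical points. The maximisation
   solves it with compactness and a first-order perturbation only. The lower bounds on the
   oscillations also keep the critical points of a competitor with [t > 0] distinct, and
   interpolation at these points requires exactly that. *)
Require Import Defs.
From HB Require Import structures.
From mathcomp Require Import all_boot all_order all_algebra.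
From mathcomp Require Import all_classical all_reals all_analysis.
From mathcomp Require Import measurable_realfun polyrcf.
From mathcomp Require Import ring lra zify.
Import Order.TTheory GRing.Theory Num.Theory.
Import numFieldNormedType.Exports.
Local Open Scope classical_set_scope.
Local Open Scope ring_scope.
Set Implicit Arguments. Unset Strict Implicit. Unset Printing Implicit Defensive.

(** * Absolutely convergent series *)

Section AbsoluteSeries.
Context {R : realType}.
Implicit Types u v : nat -> R.

(* A [Variant] rather than a [Definition]: [cvgn] unfolds to a product, which
   would make the arguments of summability lemmas implicit. *)
Variant asummable u : Prop := ASummable of cvgn (series (fun k => `|u k|)).

Definition lsum u : R := limn (series u).

Lemma asummableP u : asummable u <-> cvgn (series (fun k => `|u k|)).
Proof. by split=> [[]|]. Qed.

Lemma asummable_cvg u : asummable u -> cvgn (series u).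
Proof. by case; exact: normed_cvg. Qed.

Lemma asummable_le u v : (forall k, `|u k| <= v k) -> asummable v -> asummable u.
Proof.
move=> uv /asummableP sv; apply/asummableP; apply: series_le_cvg sv => k //.
by rewrite (le_trans (uv k)) // ler_norm.
Qed.

Lemma asummable_norm u : asummable u -> asummable (fun k => `|u k|).
Proof. by move=> /asummableP su; apply/asummableP; under eq_fun do rewrite normr_id. Qed.

Lemma asummableD u v : asummable u -> asummable v -> asummable (fun k => u k + v k).
Proof.
move=> /asummableP su /asummableP sv; apply: (@asummable_le _ (fun k => `|u k| + `|v k|)).
  by move=> k; exact: ler_normD.
apply/asummableP; under eq_fun do rewrite ger0_norm ?addr_ge0 //.
by rewrite (seriesD (fun k => `|u k|) (fun k => `|v k|)); exact: is_cvgD.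
Qed.

Lemma asummableZ (a : R) u : asummable u -> asummable (fun k => a * u k).
Proof.
move=> /asummableP su; apply/asummableP.
have -> : (fun k => `|a * u k|) = `|a| *: (fun k => `|u k|).
  by apply/funext => k; rewrite normrM.
by rewrite seriesZ; exact: is_cvgZr.
Qed.

Lemma asummableN u : asummable u -> asummable (fun k => - u k).
Proof. by move=> /asummableP su; apply/asummableP; under eq_fun do rewrite normrN. Qed.

Lemma asummableB u v : asummable u -> asummable v -> asummable (fun k => u k - v k).
Proof. by move=> su /asummableN; exact: asummableD. Qed.

Lemma lsumD u v : asummable u -> asummable v ->
  lsum (fun k => u k + v k) = lsum u + lsum v.
Proof.
move=> /asummable_cvg su /asummable_cvg sv; rewrite /lsum -limD //.
by rewrite -seriesD.
Qed.

Lemma lsumZ (a : R) u : asummable u -> lsum (fun k => a * u k) = a * lsum u.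
Proof.
move=> /asummable_cvg su; rewrite /lsum -[in RHS]/(a *: _) -limZr //.
by rewrite -seriesZ.
Qed.

Lemma lsumB u v : asummable u -> asummable v ->
  lsum (fun k => u k - v k) = lsum u - lsum v.
Proof.
move=> su sv; rewrite lsumD //; last exact: asummableN.
rewrite (_ : (fun k => - v k) = fun k => -1 * v k) ?lsumZ ?mulN1r //.
by apply/funext => k; rewrite mulN1r.
Qed.

Lemma lsum_le u v : asummable u -> asummable v ->
  (forall k, u k <= v k) -> lsum u <= lsum v.
Proof.
move=> /asummable_cvg su /asummable_cvg sv uv; apply: ler_lim => //.
by apply: nearW => n; rewrite /series /=; apply: ler_sum.
Qed.

Lemma lsum0 : lsum (fun=> 0) = 0.
Proof.
rewrite /lsum (_ : series _ = cst 0) ?lim_cst //.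
by apply/funext => n; rewrite /series /= big1.
Qed.

Lemma asummable_fin u n : (forall k, (n <= k)%N -> u k = 0) -> asummable u.
Proof.
move=> u0; apply/asummableP/cvg_ex; exists (\sum_(0 <= k < n) `|u k|).
apply: cvg_near_cst; exists n => // N /= nN; apply/eqP.
rewrite /series /= (@big_cat_nat _ _ _ n) //= [X in _ + X]big_nat_cond [X in _ + X]big1 ?addr0 //.
by move=> i /andP[/andP[/u0-> _] _]; rewrite normr0.
Qed.

Lemma lsum_fin u n : (forall k, (n <= k)%N -> u k = 0) ->
  lsum u = \sum_(k < n) u k.
Proof.
move=> u0; apply/cvg_lim => //; apply: cvg_near_cst; exists n => // N /= nN; apply/eqP.
rewrite /series /= (@big_cat_nat _ _ _ n) //= [X in _ + X]big_nat_cond [X in _ + X]big1 ?addr0 ?big_mkord //.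
by move=> i /andP[/andP[/u0-> _] _].
Qed.

Lemma asummable0 : asummable (fun=> 0).
Proof. exact: (@asummable_fin _ 0). Qed.

Lemma lsum_ge0 u : asummable u -> (forall k, 0 <= u k) -> 0 <= lsum u.
Proof. by move=> su u0; rewrite -lsum0; apply: lsum_le => //; exact: asummable0. Qed.

Lemma norm_lsum_le u v : (forall k, `|u k| <= v k) -> asummable v ->
  `|lsum u| <= lsum v.
Proof.
move=> uv sv; have su := asummable_le uv sv; rewrite ler_norml; apply/andP; split.
  have -> : - lsum v = lsum (fun k => -1 * v k) by rewrite lsumZ // mulN1r.
  by apply: lsum_le => //; [exact: asummableZ|move=> k; rewrite mulN1r; have := uv k; rewrite ler_norml => /andP[]].
by apply: lsum_le => // k; have := uv k; rewrite ler_norml => /andP[].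
Qed.

Lemma lsum_ge_partial u n : asummable u -> (forall k, 0 <= u k) ->
  \sum_(k < n) u k <= lsum u.
Proof.
move=> /asummable_cvg su u0; rewrite -(big_mkord xpredT u).
by apply: (nondecreasing_cvgn_le _ su n); exact: nondecreasing_series.
Qed.

Lemma lsum_ge_term u k : asummable u -> (forall k, 0 <= u k) -> u k <= lsum u.
Proof.
move=> su u0; apply: le_trans (lsum_ge_partial k.+1 su u0).
by rewrite big_ord_recr /= lerDr sumr_ge0.
Qed.

Lemma asummable_bounded u (M : R) : (forall k, 0 <= u k) ->
  (forall n, \sum_(k < n) u k <= M) -> asummable u.
Proof.
move=> u0 uM; apply/asummableP; rewrite (_ : (fun k => `|u k|) = u); last first.
  by apply/funext => k; rewrite ger0_norm.
apply: nondecreasing_is_cvgn; first exact: nondecreasing_series.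
by exists M => _ [n _ <-]; rewrite /series /= big_mkord.
Qed.

Lemma lsum_bounded u (M : R) : (forall k, 0 <= u k) ->
  (forall n, \sum_(k < n) u k <= M) -> lsum u <= M.
Proof.
move=> u0 uM; apply: limr_le; first exact/asummable_cvg/(asummable_bounded u0 uM).
by apply: nearW => n; rewrite /series /= big_mkord.
Qed.

Lemma lsum_split u n : asummable u ->
  lsum u = \sum_(k < n) (if (k < n)%N then u k else 0)
    + lsum (fun k => if (k < n)%N then 0 else u k).
Proof.
move=> su; rewrite -(@lsum_fin (fun k => if (k < n)%N then u k else 0) n) => [|k]; last first.
  by rewrite leqNgt; case: ifP.
rewrite -lsumD.
- by congr lsum; apply/funext => k; case: ifP; rewrite ?addr0 ?add0r.
- by apply: (@asummable_fin _ n) => k; rewrite leqNgt; case: ifP.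
- by apply: (asummable_le _ (asummable_norm su)) => k; case: ifP; rewrite ?normr0.
Qed.

End AbsoluteSeries.

(** * The Hilbert space of square-summable sequences *)

Section SquareSummable.
Context {R : realType}.
Implicit Types x y z : nat -> R.

Definition square_summable x := asummable (fun k => x k ^+ 2).

Lemma square_summableM x y : square_summable x -> square_summable y ->
  asummable (fun k => x k * y k).
Proof.
move=> sx sy; apply: (asummable_le _ (asummableD sx sy)) => k /=.
rewrite normrM -[x k ^+ 2]real_normK ?num_real // -[y k ^+ 2]real_normK ?num_real //.
have := sqr_ge0 (`|x k| - `|y k|); have := normr_ge0 (x k); have := normr_ge0 (y k).
set a := `|x k|; set b := `|y k|; nra.
Qed.

Lemma square_summableD x y : square_summable x -> square_summable y ->
  square_summable (fun k => x k + y k).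
Proof.
move=> sx sy; rewrite /square_summable.
have -> : (fun k => (x k + y k) ^+ 2) = fun k => x k ^+ 2 + y k ^+ 2 + 2 * (x k * y k).
  by apply/funext => k; ring.
by apply: asummableD; [exact: asummableD|exact/asummableZ/square_summableM].
Qed.

Lemma square_summableZ (a : R) x : square_summable x ->
  square_summable (fun k => a * x k).
Proof.
move=> sx; rewrite /square_summable.
under eq_fun do rewrite exprMn.
exact: asummableZ.
Qed.

Definition l2_pred : {pred nat -> R} := [pred x | `[< square_summable x >]].

Lemma l2_submod_closed : submod_closed l2_pred.
Proof.
split.
  apply/asboolP; rewrite /square_summable; under eq_fun do rewrite expr0n.
  exact: asummable0.
move=> a x y /asboolP sx /asboolP sy; apply/asboolP.
have -> : a *: x + y = fun k => a * x k + y k by apply/funext.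
have zx : square_summable (fun k : nat => a * x k) by exact: square_summableZ.
by have /= := square_summableD zx sy.
Qed.

HB.instance Definition _ :=
  GRing.isSubmodClosed.Build R (nat -> R) l2_pred l2_submod_closed.

Record l2 := L2 { l2_val : nat -> R; l2_valP : l2_val \in l2_pred }.

HB.instance Definition _ := [isSub for l2_val].
HB.instance Definition _ := [Choice of l2 by <:].
HB.instance Definition _ := [SubChoice_isSubLmodule of l2 by <:].

End SquareSummable.
Arguments l2 R : clear implicits.
Definition l2_fun (R : realType) (x : l2 R) : nat -> R := l2_val x.
Coercion l2_fun : l2 >-> Funclass.
Arguments l2_fun {R} x _ : simpl never.

Section L2Space.
Context {R : realType}.
Implicit Types x y z : l2 R.

Lemma l2P x : square_summable x.
Proof. exact/asboolP/(l2_valP x). Qed.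

Lemma l2ext x y : (forall k, x k = y k) -> x = y.
Proof. by move=> xy; apply/val_inj/funext. Qed.

Lemma l2D x y k : (x + y) k = x k + y k. Proof. by []. Qed.
Lemma l2B x y k : (x - y) k = x k - y k. Proof. by []. Qed.
Lemma l2Z (a : R) x k : (a *: x) k = a * x k. Proof. by []. Qed.
Lemma l20 k : (0 : l2 R) k = 0. Proof. by []. Qed.

Lemma l2_sum n (F : 'I_n -> l2 R) k : (\sum_(i < n) F i) k = \sum_(i < n) F i k.
Proof. by elim/big_rec2: _ => // i a b _ <-. Qed.

Definition l2_of (u : nat -> R) (su : square_summable u) : l2 R :=
  L2 (asboolT su : u \in l2_pred).

Definition l2_inner x y : R := lsum (fun k => x k * y k).

Lemma l2_innerDl x y z : l2_inner (x + y) z = l2_inner x z + l2_inner y z.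
Proof.
rewrite /l2_inner -lsumD; try exact/square_summableM/l2P/l2P.
by congr lsum; apply/funext => k; rewrite l2D mulrDl.
Qed.

Lemma l2_innerZl (a : R) x y : l2_inner (a *: x) y = a * l2_inner x y.
Proof.
rewrite /l2_inner -lsumZ; last exact/square_summableM/l2P/l2P.
by congr lsum; apply/funext => k; rewrite l2Z mulrA.
Qed.

Lemma l2_innerC x y : l2_inner x y = l2_inner y x.
Proof. by rewrite /l2_inner; congr lsum; apply/funext => k; rewrite mulrC. Qed.

Lemma l2_inner_ge0 x : 0 <= l2_inner x x.
Proof.
apply: lsum_ge0 => [|k]; first exact/square_summableM/l2P/l2P.
by rewrite -expr2 sqr_ge0.
Qed.

Lemma l2_coord_le x k : x k ^+ 2 <= l2_inner x x.
Proof.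
rewrite expr2; apply: (@lsum_ge_term _ (fun k => x k * x k)) => [|j].
  exact/square_summableM/l2P/l2P.
by rewrite -expr2 sqr_ge0.
Qed.

Lemma l2_cauchy_schwarz x y : l2_inner x y ^+ 2 <= l2_inner x x * l2_inner y y.
Proof.
have Q (t : R) : 0 <= l2_inner x x + 2 * t * l2_inner x y + t ^+ 2 * l2_inner y y.
  have := l2_inner_ge0 (x + t *: y).
  rewrite l2_innerDl l2_innerZl ![l2_inner _ (x + _)]l2_innerC !l2_innerDl !l2_innerZl.
  rewrite (l2_innerC y x); congr (_ <= _); ring.
set a := l2_inner x x in Q *; set b := l2_inner x y in Q *; set c := l2_inner y y in Q *.
have c0 : 0 <= c by exact: l2_inner_ge0.
have [c_eq|c_ne] := eqVneq c 0.
  rewrite c_eq mulr0; have [->|b0] := eqVneq b 0; first by rewrite expr0n.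
  (* For [c = 0] the quadratic is affine in [t], and this [t] would give it the value -1. For
     [c > 0] the minimiser [- b / c] is used below. *)
  have := Q (- (a + 1) / (2 * b)); rewrite c_eq mulr0 addr0.
  rewrite (_ : 2 * _ * b = - (a + 1)); last by field.
  by lra.
have cp : 0 < c by rewrite lt_def c_ne.
have := Q (- b / c).
rewrite (_ : a + _ + _ = (a * c - b ^+ 2) / c); last by field.
by rewrite pmulr_lge0 ?invr_gt0 // subr_ge0.
Qed.

Definition l2_norm x : R := Num.sqrt (l2_inner x x).

Lemma l2_norm_triangle x y : l2_norm (x + y) <= l2_norm x + l2_norm y.
Proof.
have n0 z : 0 <= l2_norm z by exact: sqrtr_ge0.
rewrite -(@ler_pXn2r _ 2) ?nnegrE ?addr_ge0 // sqr_sqrtr ?l2_inner_ge0 //.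
rewrite sqrrD !sqr_sqrtr ?l2_inner_ge0 //.
rewrite l2_innerDl ![l2_inner _ (x + y)]l2_innerC !l2_innerDl (l2_innerC y x).
have : l2_inner x y <= l2_norm x * l2_norm y.
  apply: le_trans (ler_norm _) _.
  rewrite -(@ler_pXn2r _ 2) ?nnegrE ?mulr_ge0 // real_normK ?num_real //.
  by rewrite exprMn !sqr_sqrtr ?l2_inner_ge0 // l2_cauchy_schwarz.
by rewrite mulr2n; lra.
Qed.

Lemma l2_normZ (a : R) x : l2_norm (a *: x) = `|a| * l2_norm x.
Proof.
rewrite /l2_norm l2_innerZl l2_innerC l2_innerZl mulrA -expr2.
by rewrite sqrtrM ?sqr_ge0 // sqrtr_sqr.
Qed.

Lemma l2_norm0_eq0 x : l2_norm x = 0 -> x = 0.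
Proof.
move=> /eqP; rewrite sqrtr_eq0 => x0; apply: l2ext => k; rewrite l20.
by apply/eqP; rewrite -sqrf_eq0 eq_le sqr_ge0 (le_trans (l2_coord_le x k) x0).
Qed.

HB.instance Definition _ :=
  @Lmodule_isNormed.Build R (l2 R) l2_norm l2_norm_triangle l2_normZ l2_norm0_eq0.

Lemma l2_normE x : `|x| ^+ 2 = l2_inner x x.
Proof. by rewrite /Num.norm /= sqr_sqrtr // l2_inner_ge0. Qed.

Lemma l2_coord_norm x k : `|x k| <= `|x|.
Proof.
rewrite -(@ler_pXn2r _ 2) ?nnegrE // l2_normE real_normK ?num_real //.
exact: l2_coord_le.
Qed.

Lemma l2_norm_le x (M : R) : 0 <= M ->
  (forall n, \sum_(k < n) x k ^+ 2 <= M ^+ 2) -> `|x| <= M.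
Proof.
move=> M0 xM; rewrite -(@ler_pXn2r _ 2) ?nnegrE // l2_normE.
apply: lsum_bounded => [k|n]; first by rewrite -expr2 sqr_ge0.
by under eq_bigr do rewrite -expr2.
Qed.

Lemma l2_partial_norm x n : \sum_(k < n) x k ^+ 2 <= `|x| ^+ 2.
Proof.
rewrite l2_normE; under eq_bigr do rewrite expr2.
apply: lsum_ge_partial => [|k]; first exact/square_summableM/l2P/l2P.
by rewrite -expr2 sqr_ge0.
Qed.

(** The limit is built coordinatewise. A bound on a finite sum of squares is a closed condition, so
    it survives the limit in one argument ([close]); this first shows that the limit is square
    summable and then gives convergence in norm. *)
Lemma l2_complete (F : set_system (l2 R)) : ProperFilter F -> cauchy F -> cvg F.
Proof.
move=> FF /cauchy_ballP Fc.
have coord_cvg k : cvg ((fun x : l2 R => x k) @ F).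
  apply: cauchy_cvg; apply/cauchy_ballP => e e0.
  have [[A B] /= [FA FB] AB] := Fc _ e0.
  exists ((fun x : l2 R => x k) @` A, (fun x : l2 R => x k) @` B).
    by split => /=; [apply: filterS FA|apply: filterS FB] => x Ax; exists x.
  move=> [_ _] /= [[x Ax <-] [z Bz <-]]; have := AB (x, z) (conj Ax Bz).
  rewrite -!ball_normE /= -l2B; exact/le_lt_trans/l2_coord_norm.
pose y k := lim ((fun x : l2 R => x k) @ F).
have close e : 0 < e -> exists2 A, F A &
    forall x, A x -> forall n, \sum_(k < n) (x k - y k) ^+ 2 <= e ^+ 2.
  move=> e0; have [[A B] /= [FA FB] AB] := Fc _ e0.
  exists A => // x Ax n.
  have cv : (fun z : l2 R => \sum_(k < n) (x k - z k) ^+ 2) z @[z --> F] -->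
      \sum_(k < n) (x k - y k) ^+ 2.
    apply: cvg_big => [|k _]; first exact: add_continuous.
    by rewrite expr2; apply: cvgM; (apply: cvgB; [exact: cvg_cst|exact: coord_cvg]).
  apply: (closed_cvg (fun t => t <= e ^+ 2)) cv; first exact: closed_le.
  apply: filterS FB => z Bz.
  have := AB (x, z) (conj Ax Bz); rewrite -ball_normE /= => /ltW xz.
  apply: le_trans (l2_partial_norm (x - z) n) _.
  by rewrite ler_pXn2r ?nnegrE // ltW.
have sy : square_summable y.
  have [A FA HA] := close 1 ltr01.
  have [x Ax] := filter_ex FA.
  have sxy : square_summable (fun k => x k - y k).
    by apply: (@asummable_bounded _ _ (1 ^+ 2)) => [k|n]; [exact: sqr_ge0|exact: HA].
  have -> : y = fun k => x k + (-1) * (x k - y k) by apply/funext => k; ring.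
  by apply: square_summableD; [exact: l2P|exact: square_summableZ].
apply/cvg_ex; exists (l2_of sy); apply/cvgrPdist_le => e e0.
have [A FA HA] := close e e0.
apply: filterS FA => x Ax; rewrite distrC; apply: l2_norm_le (ltW e0) _ => n.
exact: HA.
Qed.

HB.instance Definition _ := Uniform_isComplete.Build (l2 R) l2_complete.

End L2Space.

Definition l2_hilbert (R : realType) : hilbertSpace R :=
  @HilbertSpace R (l2 R) l2_inner l2_innerDl l2_innerZl l2_innerC l2_normE.

(** * Polynomials with equally spaced critical values *)

Section CriticalValues.
Context {R : realType}.
Implicit Types (p q : {poly R}) (c u y : nat -> R).

Definition primitive p : {poly R} := \poly_(l < (size p).+1) (p`_l.-1 / l%:R).

(* At [l = 0] the quotient is [p`_0 / 0 = 0]. *)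
Lemma coef_primitive p l : (primitive p)`_l = p`_l.-1 / l%:R.
Proof.
rewrite coef_poly; case: ltnP => // pl; rewrite nth_default ?mul0r //.
by rewrite -ltnS prednK //; exact: leq_ltn_trans pl.
Qed.

Lemma deriv_primitive p : (primitive p)^`() = p.
Proof.
apply/polyP => l; rewrite coef_deriv coef_primitive /= -[_ *+ _]mulr_natr -mulrA.
by rewrite mulVf ?mulr1 // pnatr_eq0.
Qed.

Lemma size_primitive p : (size (primitive p) <= (size p).+1)%N.
Proof. exact: size_poly. Qed.

Lemma primitive_is_linear : linear primitive.
Proof.
by move=> a p q; apply/polyP => l; rewrite !(coefD, coefZ, coef_primitive) mulrDl mulrA.
Qed.

HB.instance Definition _ :=
  GRing.isLinear.Build R {poly R} {poly R} _ primitive primitive_is_linear.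

Lemma deriv_eq_sub p q (x y : R) : p^`() = q^`() -> p.[x] - p.[y] = q.[x] - q.[y].
Proof.
move=> pq; have /eqP := pq; rewrite -subr_eq0 -derivB => /eqP d0.
have /size1_polyC E : (size (p - q)%R <= 1)%N.
  apply/leq_sizeP => -[//|l] _; have := congr1 (fun r : {poly R} => r`_l) d0.
  rewrite coef_deriv coef0 => /eqP; rewrite -mulr_natr mulf_eq0 pnatr_eq0 orbF.
  by move/eqP.
have F z : p.[z] = q.[z] + (p - q)`_0.
  by rewrite -{1}[p](subrK q) hornerD {1}E hornerC addrC.
by rewrite !F; ring.
Qed.

(** Newton's scheme: a multiple of the node polynomial [w] corrects the value at the new node and
    leaves the earlier ones alone. *)
Lemma interpolation n c y : (forall i j, (i < n)%N -> (j < n)%N -> c i = c j -> i = j) ->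
  exists2 q : {poly R}, (size q <= n)%N & forall k, (k < n)%N -> q.[c k] = y k.
Proof.
elim: n => [_|n IH cinj]; first by exists 0 => //; rewrite size_poly0.
have [|q sq qy] := IH; first by move=> i j ilt jlt; apply: cinj; exact: ltnW.
pose w := \prod_(j < n) ('X - (c j)%:P).
have wk k : w.[c k] = \prod_(j < n) (c k - c j).
  by rewrite horner_prod; apply: eq_bigr => j _; rewrite hornerXsubC.
have wn0 : w.[c n] != 0.
  rewrite wk; apply/prodf_neq0 => j _; rewrite subr_eq0; apply/eqP => cnj.
  by have := cinj n j (ltnSn n) (ltnW (ltn_ord j)) cnj; have := ltn_ord j; lia.
exists (q + ((y n - q.[c n]) / w.[c n]) *: w).
  rewrite (leq_trans (size_polyD _ _)) // geq_max (leq_trans sq) //=.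
  apply: leq_trans (size_scale_leq _ _) _.
  by rewrite size_prod_XsubC // /index_enum -enumT size_enum_ord.
move=> k; rewrite ltnS leq_eqVlt => /orP[/eqP->|kn]; rewrite hornerD hornerZ.
  by rewrite divfK // addrC subrK.
by rewrite qy // [w.[c k]]wk (bigD1 (Ordinal kn)) //= subrr mul0r mulr0 addr0.
Qed.

Lemma eq_poly_on n p q c : (forall i j, (i < n)%N -> (j < n)%N -> c i = c j -> i = j) ->
  (size p <= n)%N -> (size q <= n)%N ->
  (forall k, (k < n)%N -> p.[c k] = q.[c k]) -> p = q.
Proof.
move=> cinj sp sq pq; apply/eqP; rewrite -subr_eq0; apply/eqP.
apply: (@roots_geq_poly_eq0 _ _ (map c (iota 0 n))).
- apply/allP => _ /mapP[k + ->]; rewrite mem_iota /= add0n => kn.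
  by rewrite rootE hornerD hornerN pq // subrr.
- rewrite map_inj_in_uniq ?iota_uniq // => i j.
  by rewrite !mem_iota /= !add0n; exact: cinj.
- rewrite size_map size_iota (leq_trans (size_polyD _ _)) // geq_max size_polyN sp //.
Qed.

(** * First-order motion of the critical values when the critical points move *)

Definition crit_poly n c : {poly R} := \prod_(j < n) ((c j)%:P - 'X).

Lemma crit_poly_root n c k : (k < n)%N -> (crit_poly n c).[c k] = 0.
Proof.
move=> kn; rewrite horner_prod (bigD1 (Ordinal kn)) //= !hornerE subrr mul0r //.
Qed.

Lemma crit_poly_horner n c x : (crit_poly n c).[x] = \prod_(j < n) (c j - x).
Proof. by rewrite horner_prod; apply: eq_bigr => j _; rewrite !hornerE. Qed.

(* The outer variable of [pencil] is the perturbation parameter: its value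
   at [t%:P] is [crit_poly n (c + t u)]. *)
Definition pencil n c u : {poly {poly R}} :=
  \prod_(j < n) (((c j)%:P - 'X)%:P + (u j)%:P%:P * 'X).

Lemma pencil_horner n c u t :
  (pencil n c u).[t%:P] = crit_poly n (fun j => c j + t * u j).
Proof.
rewrite horner_prod; apply: eq_bigr => j _; rewrite !hornerE polyCD polyCM.
by rewrite [t%:P * _]mulrC addrAC.
Qed.

(** Each of the [n] factors supplies either a power of the parameter or at most one power of the
    inner variable. *)
Lemma size_coef_pencil n c u l : (size ((pencil n c u)`_l)%R <= n.+1 - l)%N.
Proof.
elim: n l => [|n IH] l.
  rewrite /pencil big_ord0 coef1; case: l => [|l] /=; first by rewrite size_poly1.
  by rewrite size_poly0.
rewrite /pencil big_ord_recr /= -/(pencil n c u) mulrDr coefD coefMC mulrA coefMX.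
have sc : (size (((c n)%:P - 'X)%R : {poly R}) <= 2)%N.
  by rewrite -opprB size_polyN size_XsubC.
rewrite (leq_trans (size_polyD _ _)) // geq_max; apply/andP; split.
  have [->|nz] := eqVneq (pencil n c u)`_l 0; first by rewrite mul0r size_poly0.
  apply: leq_trans (size_polyMleq _ _) _; move: (IH l) nz sc; rewrite -size_poly_gt0.
  by move: (size (pencil n c u)`_l) (size (_ - 'X)) => a b; lia.
case: l => [|l] /=; first by rewrite size_poly0.
rewrite coefMC mulrC mul_polyC; apply: leq_trans (size_scale_leq _ _) _.
exact: IH.
Qed.

Lemma coef0_pencil n c u : (pencil n c u)`_0 = crit_poly n c.
Proof.
rewrite -horner_coef0 -[0]/(0%:P) pencil_horner; congr crit_poly.
by apply/funext => j; rewrite mul0r addr0.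
Qed.

(** At [c k] the [k]-th factor reduces to [u k] times the parameter, so the linear coefficient takes
    all other factors at parameter 0. *)
Lemma coef1_pencil_horner n c u (k : 'I_n) :
  ((pencil n c u)`_1).[c k] = u k * \prod_(j < n | j != k) (c j - c k).
Proof.
have -> : ((pencil n c u)`_1).[c k] = (map_poly (horner_eval (c k)) (pencil n c u))`_1.
  by rewrite coef_map.
rewrite rmorph_prod.
have E j : map_poly (horner_eval (c k)) (((c j)%:P - 'X)%:P + (u j)%:P%:P * 'X) =
    (c j - c k)%:P + (u j)%:P * 'X.
  by rewrite rmorphD rmorphM /= !map_polyC /= map_polyX /horner_eval !hornerE.
rewrite (eq_bigr (fun j : 'I_n => (c j - c k)%:P + (u j)%:P * 'X)) => [|j _]; last exact: E.
rewrite (bigD1 k) //= subrr add0r mulrAC coefMX /= -horner_coef0 hornerM hornerC.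
by congr (_ * _); rewrite horner_prod; apply: eq_bigr => j _; rewrite !hornerE.
Qed.

Lemma poly_first_order p : exists2 C : R, 0 <= C &
  forall t : R, 0 <= t <= 1 -> `|p.[t] - p`_0 - t * p`_1| <= C * t ^+ 2.
Proof.
have [r [a [b ->]]] : exists (r : {poly R}) (a b : R), p = (r * 'X + b%:P) * 'X + a%:P.
  elim/poly_ind: p => [|q a _]; first by exists 0, 0, 0; rewrite !mul0r !addr0 mul0r.
  elim/poly_ind: q => [|r b _]; last by exists r, a, b.
  by exists 0, a, 0; rewrite !mul0r addr0 mul0r.
exists (\sum_(l < size r) `|r`_l|); first by rewrite sumr_ge0.
move=> t /andP[t0 t1].
have -> : ((r * 'X + b%:P) * 'X + a%:P)`_0 = a by rewrite coefD coefMX coefC add0r.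
have -> : ((r * 'X + b%:P) * 'X + a%:P)`_1 = b.
  by rewrite coefD coefMX coefC /= addr0 coefD coefMX coefC add0r.
have -> : ((r * 'X + b%:P) * 'X + a%:P).[t] - a - t * b = r.[t] * t ^+ 2.
  by rewrite !(hornerD, hornerMX, hornerC); ring.
rewrite normrM [`|t ^+ 2|]ger0_norm ?sqr_ge0 // ler_wpM2r ?sqr_ge0 //.
rewrite horner_coef (le_trans (ler_norm_sum _ _ _)) // ler_sum // => l _.
by rewrite normrM ler_piMr // ger0_norm ?exprn_ge0 // exprn_ile1.
Qed.

(* Moving the critical points along [u] moves the critical values to first
   order by the primitive of [(pencil n c u)`_1], and interpolation makes this
   primitive take any prescribed values (up to a common constant). *)
Lemma perturb_critical_values n c y :
  (forall i j, (i < n)%N -> (j < n)%N -> c i = c j -> i = j) ->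
  exists u : nat -> R, exists K : R, exists2 C : R, 0 <= C &
  forall (t : R) i, 0 <= t <= 1 -> (i < n)%N ->
    `|(primitive (crit_poly n (fun j => c j + t * u j))).[c i + t * u i]
      - (primitive (crit_poly n c)).[c i] - t * (y i + K)| <= C * t ^+ 2.
Proof.
move=> cinj; have [q sq qy] := interpolation y cinj.
(* This [u] makes the linear coefficient of the pencil agree with the derivative of [q] at the [n]
   distinct nodes; both have size at most [n], hence they are equal. *)
pose u k := if (k < n)%N then q^`().[c k] / \prod_(j < n | (j : nat) != k) (c j - c k) else 0.
have B1 : (pencil n c u)`_1 = q^`().
  apply: (eq_poly_on cinj).
  - by apply: leq_trans (size_coef_pencil _ _ _ _) _; rewrite subn1.
  - by rewrite (leq_trans _ sq) // (leq_trans (size_poly _ _)) // leq_pred.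
  move=> k kn; rewrite (coef1_pencil_horner _ _ (Ordinal kn)) /= /u kn divfK //.
  apply/prodf_neq0 => j jk; rewrite subr_eq0; apply/negP => /eqP cjk.
  by move/eqP: jk; apply; apply: cinj => //; exact: ltn_ord.
pose B := pencil n c u.
pose W i : {poly R} :=
  \sum_(l < size B) (primitive B`_l \Po ((c i)%:P + (u i)%:P * 'X)) * 'X^l.
have WE i t : (W i).[t] = (primitive (crit_poly n (fun j => c j + t * u j))).[c i + t * u i].
  rewrite -pencil_horner [(pencil _ _ _).[_]]horner_coef linear_sum /= !horner_sum.
  apply: eq_bigr => l _; rewrite hornerM horner_comp hornerXn !hornerE.
  by rewrite -polyC_exp [_ * (t ^+ l)%:P]mulrC mul_polyC linearZ /= hornerZ [u i * t]mulrC [RHS]mulrC.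
have W0 i : (W i)`_0 = (primitive (crit_poly n c)).[c i].
  rewrite -horner_coef0 WE mul0r addr0; congr (primitive (crit_poly n _)).[_].
  by apply/funext => j; rewrite mul0r addr0.
(* Displacing the evaluation point contributes [u i] times the derivative at [c i], which is 0
   because [c i] is critical. Only the change of the polynomial remains. *)
have W1 i : (i < n)%N -> (W i)`_1 = y i - q.[0].
  move=> in_; have -> : (W i)`_1 = (W i)^`().[0] by rewrite horner_coef0 coef_deriv.
  have -> : (W i)^`().[0] = \sum_(l < size B) (if l == 0%N :> nat then 0 else
        if l == 1%N :> nat then (primitive B`_l).[c i] else 0).
    rewrite /W raddf_sum horner_sum; apply: eq_bigr => l _ /=.
    set g := _ \Po _.
    have g0 : g.[0] = (primitive B`_l).[c i] by rewrite horner_comp !hornerE ?mulr0 ?addr0.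
    have g1 : g^`().[0] = (B`_l).[c i] * u i.
      rewrite deriv_comp hornerM horner_comp deriv_primitive derivD derivC add0r.
      by rewrite derivM derivC mul0r add0r derivX mulr1 !hornerE ?mulr0 ?addr0.
    rewrite derivM hornerD !hornerM g0 g1 derivXn hornerXn hornerMn hornerXn.
    case: (l : nat) => [|[|l']] /=.
    + by rewrite coef0_pencil crit_poly_root // !mul0r add0r mulr0n mulr0.
    + by rewrite expr1 mulr0 add0r expr0 mulr1.
    + by rewrite !expr0n /= mul0rn !mulr0 addr0.
  (* [primitive] vanishes at 0 whereas [q] need not; the common constant [K = - q.[0]] comes from
     there and cancels in differences of critical values. *)
  have pE : (primitive B`_1).[c i] = y i - q.[0].
    rewrite -[LHS]subr0 -[X in _ - X](_ : (primitive B`_1).[0] = 0); last first.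
      by rewrite horner_coef0 coef_primitive invr0 mulr0.
    by rewrite (@deriv_eq_sub _ q) ?deriv_primitive // qy.
  case E : (size B) => [|[|s]].
  - rewrite big_ord0 -pE nth_default ?E // raddf0 horner0 //.
  - by rewrite big_ord_recl big_ord0 /= addr0 -pE nth_default ?E // raddf0 horner0.
  - rewrite !big_ord_recl /= add0r big1 ?addr0 ?pE // => l _.
have bnd i : exists C : R, 0 <= C /\ (forall t : R, 0 <= t <= 1 ->
    `|(W i).[t] - (W i)`_0 - t * (W i)`_1| <= C * t ^+ 2).
  by have [C C0 HC] := poly_first_order (W i); exists C.
have {bnd} [Cf HCf] := choice bnd.
exists u, (- q.[0]), (\sum_(i < n) Cf i); first by rewrite sumr_ge0 // => i _; case: (HCf i).
move=> t i t01 in_; rewrite -WE -W0 -W1 //.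
apply: le_trans ((HCf i).2 t t01) _; rewrite ler_wpM2r ?sqr_ge0 //.
rewrite (bigD1 (Ordinal in_)) //= lerDl sumr_ge0 // => j _.
by case: (HCf j).
Qed.

(** The oscillation between neighbouring critical points, with its known sign in place of an
    absolute value: for ordered nodes the derivative [\prod_j (c_j - X)] has sign [(-1)^(i+1)]
    between [c i] and [c i.+1]. This keeps it polynomial in the nodes. *)
Definition gapval n c i : R :=
  (-1) ^+ i * ((primitive (crit_poly n c)).[c i] - (primitive (crit_poly n c)).[c i.+1]).

Lemma crit_poly_sign n c i (x : R) : (i < n)%N ->
  (forall j, (j <= i)%N -> c j < x) -> (forall j, (i < j < n)%N -> x < c j) ->
  0 < (-1) ^+ i.+1 * (crit_poly n c).[x].
Proof.
move=> in_ lo hi; rewrite crit_poly_horner -(big_mkord xpredT (fun j => c j - x)).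
rewrite (@big_cat_nat _ _ _ i.+1) //= mulrA.
rewrite (eq_bigr (fun j => (-1) * (x - c j))) => [|j _]; last by rewrite mulN1r opprB.
rewrite big_split /= prodr_const_nat subn0 mulrA -exprMn mulrNN mulr1 expr1n mul1r.
rewrite mulr_gt0 // big_nat_cond prodr_gt0 // => j /andP[/andP[j1 j2] _].
  by rewrite subr_gt0 lo.
by rewrite subr_gt0 hi // j1.
Qed.

Lemma gapval_gt0 e c i : (forall j k, (j <= k <= e)%N -> c j <= c k) ->
  (i < e)%N -> c i < c i.+1 -> 0 < gapval e.+1 c i.
Proof.
move=> cmono ie ci; rewrite /gapval.
have [x /[!in_itv] /= /andP[x1 x2] E] := poly_mvt (primitive (crit_poly e.+1 c)) ci.
rewrite -opprB E deriv_primitive -mulNr mulrA mulrN -mulNr -mulN1r -exprS mulr_gt0 ?subr_gt0 //.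
apply: crit_poly_sign; first exact: ltnW.
- by move=> j ji; apply: le_lt_trans x1; apply: cmono; rewrite ji ltnW.
- by move=> j /andP[ij je]; apply: lt_le_trans x2 _; apply: cmono; rewrite ij.
Qed.

Lemma gapval_ge0 e c i : (forall j k, (j <= k <= e)%N -> c j <= c k) ->
  (i < e)%N -> 0 <= gapval e.+1 c i.
Proof.
move=> cmono ie; have := cmono i i.+1; rewrite leqnSn ie => /(_ isT).
rewrite le_eqVlt => /orP[/eqP E|lt]; first by rewrite /gapval E subrr mulr0.
exact/ltW/gapval_gt0.
Qed.

(** Oscillations are homogeneous of degree [n + 1] under affine changes of variable: [n] from the
    factors of the derivative and one from integration. *)
Lemma gapval_affine n z (a L : R) i : L != 0 ->
  gapval n z i = L ^+ n.+1 * gapval n (fun j => (z j - a) / L) i.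
Proof.
move=> L0; pose c j := (z j - a) / L.
pose q := primitive (crit_poly n c) \Po (L^-1 *: ('X - a%:P)).
have qE x : q.[x] = (primitive (crit_poly n c)).[(x - a) / L].
  by rewrite /q horner_comp hornerZ hornerXsubC mulrC.
have dq : (L ^+ n.+1 *: q)^`() = (primitive (crit_poly n z))^`().
  rewrite deriv_primitive derivZ /q deriv_comp deriv_primitive derivZ derivXsubC.
  rewrite mulr_algr scalerA exprSr mulfK //.
  rewrite /crit_poly rmorph_prod /= -[L ^+ n]/(L ^+ n)%R -[n in L ^+ n]card_ord -prodr_const.
  rewrite -scaler_prod; apply: eq_bigr => j _.
  rewrite rmorphB /= comp_polyC comp_polyX scalerBr scalerA mulfV // scale1r.
  by rewrite -mul_polyC -polyCM /c mulrC divfK // polyCB opprB addrA subrK.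
rewrite /gapval -(deriv_eq_sub _ _ dq) !hornerZ !qE -/(c i) -/(c i.+1); ring.
Qed.

(** Alternating partial sums turn a prescribed list [g] of oscillations into critical values
    realising it. *)
Lemma sum_gapval_shift (g : nat -> R) i :
  (-1) ^+ i * (- (\sum_(0 <= j < i) (-1) ^+ j * g j) - - (\sum_(0 <= j < i.+1) (-1) ^+ j * g j)) = g i.
Proof.
rewrite big_nat_recr //= opprK addrA addNr add0r mulrA -exprD addnn -mul2n exprM.
by rewrite sqrrN expr1n expr1n mul1r.
Qed.

Lemma exists_pos_lb n (x : nat -> R) : (forall i, (i < n)%N -> 0 < x i) ->
  exists2 t : R, 0 < t & forall i, (i < n)%N -> t <= x i.
Proof.
elim: n => [_|n IH xp]; first by exists 1.
have [|t t0 tx] := IH; first by move=> i lt; apply: xp; exact: ltnW.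
exists (Num.min t (x n)); first by rewrite lt_min t0 xp.
move=> i; rewrite ltnS leq_eqVlt => /orP[/eqP->|lt]; first by rewrite ge_min lexx orbT.
by rewrite ge_min tx.
Qed.

End CriticalValues.

(** * Continuity of the critical values in the critical points *)

Section CriticalValuesContinuity.
Context {R : realType} {T : topologicalType} (cf : T -> nat -> R).
Hypothesis cf_cont : forall j, continuous (fun v => cf v j).

Lemma continuous_bigsum (I : Type) (r : seq I) (F : I -> T -> R) :
  (forall i, continuous (F i)) -> continuous (fun v => \sum_(i <- r) F i v).
Proof. by move=> Fc v; apply: cvg_big => [|i _]; [exact: add_continuous|exact: Fc]. Qed.

Lemma continuous_power (F : T -> R) l : continuous F -> continuous (fun v => F v ^+ l).
Proof.
move=> Fc; elim: l => [|l IH] v; first exact: cvg_cst.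
under eq_fun do rewrite exprS.
by apply: cvgM; [exact: Fc|exact: IH].
Qed.

Lemma continuous_coef_crit_poly n l : continuous (fun v => (crit_poly n (cf v))`_l).
Proof.
elim: n l => [|n IH] l v.
  by rewrite /crit_poly; under eq_fun do rewrite big_ord0; exact: cvg_cst.
have E w : (crit_poly n.+1 (cf w))`_l = (crit_poly n (cf w))`_l * cf w n -
    (if l == 0 then 0 else (crit_poly n (cf w))`_l.-1).
  by rewrite /crit_poly big_ord_recr /= mulrBr coefB coefMC coefMX.
under eq_fun do rewrite E.
apply: cvgB; first by apply: cvgM; [exact: IH|exact: cf_cont].
by case: eqP => _; [exact: cvg_cst|exact: IH].
Qed.

Lemma continuous_primitive_crit_poly n j :
  continuous (fun v => (primitive (crit_poly n (cf v))).[cf v j]).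
Proof.
have E w : (primitive (crit_poly n (cf w))).[cf w j] =
    \sum_(l < n.+2) (crit_poly n (cf w))`_l.-1 / l%:R * cf w j ^+ l.
  rewrite (@horner_coef_wide _ n.+2).
    by apply: eq_bigr => l _; rewrite coef_primitive.
  apply: leq_trans (size_primitive _) _; rewrite ltnS.
  by have := size_coef_pencil n (cf w) (cf w) 0; rewrite coef0_pencil subn0.
move=> v; under eq_fun do rewrite E.
apply: continuous_bigsum => l w.
apply: cvgM; last exact: continuous_power.
by apply: cvgM; [exact: continuous_coef_crit_poly|exact: cvg_cst].
Qed.

Lemma continuous_gapval n i : continuous (fun v => gapval n (cf v) i).
Proof.
move=> v; rewrite /gapval; apply: cvgM; first exact: cvg_cst.
by apply: cvgB; exact: continuous_primitive_crit_poly.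
Qed.

End CriticalValuesContinuity.

(** * The extremal problem for the oscillations *)

Section EquispacedCriticalValues.
Context {R : realType}.
Implicit Types (c : nat -> R).

Definition mono_upto e c := forall j k, (j <= k <= e)%N -> c j <= c k.

Lemma mono_uptoP e c : (forall i, (i < e)%N -> c i <= c i.+1) -> mono_upto e c.
Proof.
move=> step j k /andP[jk]; elim: k jk => [|k IH].
  by rewrite leqn0 => /eqP->.
rewrite leq_eqVlt => /orP[/eqP->//|jk] ke.
by apply: le_trans (step _ ke); apply: IH => //; exact: ltnW.
Qed.

(* The largest [t] with [slack e c t] for some [c] forces equality for every [i]. *)
Definition slack e c (t : R) := forall i, (i < e)%N ->
  t * i.+1%:R * (\sum_(j < e) gapval e.+1 c j) <= gapval e.+1 c i.

Definition weight_sum e : R := \sum_(j < e) j.+1%:R.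

Lemma weight_sum_ge1 e : (0 < e)%N -> 1 <= weight_sum e.
Proof.
case: e => // e _; rewrite /weight_sum big_ord_recl /= lerDl sumr_ge0 //.
Qed.

Lemma sum_gapval_gt0 e c : mono_upto e c -> c 0%N < c e ->
  0 < \sum_(j < e) gapval e.+1 c j.
Proof.
move=> cm c0e.
have [i ie ci] : exists2 i, (i < e)%N & c i < c i.+1.
  apply: contrapT => no; have : mono_upto e (fun j => - c j).
    apply: mono_uptoP => i ie; rewrite lerN2 leNgt; apply/negP => ci.
    by apply: no; exists i.
  by move=> /(_ 0%N e); rewrite leqnn lerN2 leNgt c0e => /(_ isT).
rewrite (bigD1 (Ordinal ie)) //=; apply: ltr_pwDl; first exact: gapval_gt0.
by rewrite sumr_ge0 // => j _; exact: gapval_ge0.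
Qed.

(** Sum the inequalities of [slack] and cancel the positive total oscillation. If
    [t * weight_sum e = 1], every one of them must be an equality. *)
Lemma slack_le e c t : mono_upto e c -> c 0%N < c e -> slack e c t ->
  t * weight_sum e <= 1.
Proof.
move=> cm c0e ct; have T0 := sum_gapval_gt0 cm c0e.
rewrite -(ler_pM2r T0) mul1r /weight_sum [t * _]mulr_sumr mulr_suml.
by apply: ler_sum => i _; exact: ct.
Qed.

(** Merged neighbours would have oscillation 0, below the positive bound that [slack] imposes. *)
Lemma slack_strict e c t : 0 < t -> mono_upto e c -> c 0%N < c e -> slack e c t ->
  forall i, (i < e)%N -> c i < c i.+1.
Proof.
move=> t0 cm c0e ct i ie; rewrite lt_neqAle cm ?leqnSn // andbT; apply/eqP => E.
have := ct i ie; rewrite {2}/gapval -E subrr mulr0 leNgt.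
by rewrite !mulr_gt0 // sum_gapval_gt0.
Qed.

Lemma slack_affine e c t a L : 0 < L ->
  slack e c t -> slack e (fun j => (c j - a) / L) t.
Proof.
move=> L0 ct i ie; have P0 : 0 < L ^+ e.+2 by rewrite exprn_gt0.
rewrite -(ler_pM2l P0) -gapval_affine ?gt_eqF // mulrCA mulr_sumr.
under eq_bigr do rewrite -gapval_affine ?gt_eqF //.
exact: ct.
Qed.

(** Move the oscillations a fraction [s] of the way towards the proportional profile of the same
    total. The admissible [t] grows at rate [gam = 1 / weight_sum e - t > 0], the errors are of
    order [s^2], and so half of the gain survives for small [s]. *)
Lemma slack_improve e c (t : R) : (0 < e)%N -> 0 < t -> mono_upto e c -> c 0%N < c e ->
  slack e c t -> t * weight_sum e < 1 ->
  exists z, exists2 t' : R, [/\ mono_upto e z, z 0%N < z e & slack e z t'] & t < t'.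
Proof.
move=> e0 t0 cm c0e ct tw.
have cs := slack_strict t0 cm c0e ct.
have W1 := weight_sum_ge1 e0.
have W0 : 0 < weight_sum e by exact: lt_le_trans W1.
set T := \sum_(j < e) gapval e.+1 c j.
have T0 : 0 < T by exact: sum_gapval_gt0.
(* The displacement from the present oscillations to the proportional ones. It sums to 0, so the
   total changes only to second order. *)
pose g i := i.+1%:R * T / weight_sum e - gapval e.+1 c i.
pose y i := - (\sum_(0 <= j < i) (-1) ^+ j * g j).
have cs_lt i j : (i < j <= e)%N -> c i < c j.
  case: j => // j /andP[ij je]; apply: le_lt_trans (cs j je); apply: cm.
  by rewrite -ltnS ij ltnW.
have cinj i j : (i < e.+1)%N -> (j < e.+1)%N -> c i = c j -> i = j.
  rewrite !ltnS => ie je E; case: (ltngtP i j) => // lt.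
    by have := @cs_lt i j; rewrite lt je E ltxx => /(_ isT).
  by have := @cs_lt j i; rewrite lt ie E ltxx => /(_ isT).
have [u [K [C C0 HC]]] := perturb_critical_values y cinj.
pose z (s : R) j := c j + s * u j.
have gap (s : R) i : 0 <= s <= 1 -> (i < e)%N ->
    `|gapval e.+1 (z s) i - gapval e.+1 c i - s * g i| <= 2 * C * s ^+ 2.
  move=> s01 ie.
  have H1 := HC s i s01 (ltnW ie); have H2 := HC s i.+1 s01 ie.
  have gE : g i = (-1) ^+ i * (y i - y i.+1) by rewrite /y sum_gapval_shift.
  rewrite gE /gapval -/(z s) -[c i + _]/(z s i) -[c i.+1 + _]/(z s i.+1) in H1 H2 *.
  set a := (primitive (crit_poly _ (z s))).[z s i] in H1 *.
  set b := (primitive (crit_poly _ (z s))).[z s i.+1] in H2 *.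
  set a0 := (primitive _).[c i] in H1 *; set b0 := (primitive _).[c i.+1] in H2 *.
  have -> : (-1) ^+ i * (a - b) - (-1) ^+ i * (a0 - b0) - s * ((-1) ^+ i * (y i - y i.+1)) =
    (-1) ^+ i * ((a - a0 - s * (y i + K)) - (b - b0 - s * (y i.+1 + K))) by ring.
  rewrite normrM normrX normrN1 expr1n mul1r.
  by apply: le_trans (ler_normB _ _) _; apply: le_trans (lerD H1 H2) _; lra.
have sumg : \sum_(j < e) g j = 0.
  rewrite sumrB -/T -mulr_suml -mulr_suml -/(weight_sum e) [_ * T]mulrC mulfK ?subrr //.
  exact: lt0r_neq0.
have [gm gm0 Hgm] : exists2 gm : R, 0 < gm & forall i, (i < e)%N -> gm <= c i.+1 - c i.
  by apply: (exists_pos_lb (x := fun i => c i.+1 - c i)) => i ie; rewrite subr_gt0 cs.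
pose U : R := \sum_(j < e.+1) `|u j|.
have uU j : (j <= e)%N -> `|u j| <= U.
  move=> je; rewrite /U (bigD1 (Ordinal (je : (j < e.+1)%N))) //= lerDl.
  by rewrite sumr_ge0.
have U0 : 0 <= U by rewrite sumr_ge0.
pose gam := (weight_sum e)^-1 - t.
have gam0 : 0 < gam by rewrite subr_gt0 -[_^-1]mul1r ltr_pdivlMr.
(* [M] collects the quadratic errors: [2 C] from the oscillation itself, the rest from the total of
   [e] oscillations. Below, [s * (2 * U) < gm] keeps the nodes ordered and [s * M <= T * gam / 2]
   limits the loss to half of the gain. *)
pose M := 2 * C + (t + gam) * (2 * e%:R * C).
have M0 : 0 <= M by rewrite addr_ge0 ?mulr_ge0 // addr_ge0 // ltW.
have [s /andP[s0 s1] [sgap sM]] : exists2 s : R, 0 < s <= 1 &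
    s * (2 * U) < gm /\ s * M <= T * gam / 2.
  pose s : R := Num.min 1 (Num.min (gm / (2 * U + 1)) (T * gam / 2 / (M + 1))).
  have s0 : 0 < s by rewrite !lt_min ltr01 !divr_gt0 ?mulr_gt0 // ltr_wpDl ?mulr_ge0.
  exists s; first by rewrite s0 ge_min lexx.
  split.
    have : s <= gm / (2 * U + 1) by rewrite /s !ge_min lexx orbT.
    by rewrite ler_pdivlMr ?ltr_wpDl ?mulr_ge0 // mulrDr mulr1; lra.
  have : s <= T * gam / 2 / (M + 1) by rewrite /s !ge_min lexx !orbT.
  by rewrite ler_pdivlMr ?ltr_wpDl // mulrDr mulr1; lra.
have s01 : 0 <= s <= 1 by rewrite ltW.
have zstep i : (i < e)%N -> z s i < z s i.+1.
  move=> ie; have := Hgm i ie; have := uU i (ltnW ie); have := uU i.+1 ie.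
  rewrite !ler_norml => /andP[a1 a2] /andP[b1 b2] ge_gm; rewrite /z.
  have : s * (u i - u i.+1) <= s * (2 * U) by rewrite ler_pM2l //; lra.
  by rewrite mulrBr; lra.
have zm : mono_upto e (z s) by apply: mono_uptoP => i ie; exact/ltW/zstep.
have z0e : z s 0%N < z s e.
  by apply: lt_le_trans (zstep 0%N e0) _; apply: zm; rewrite e0 leqnn.
exists (z s), (t + s * gam / 2); last by rewrite ltrDl divr_gt0 ?mulr_gt0.
split => // i ie.
set Tz := \sum_(j < e) gapval e.+1 (z s) j.
have TzT : Tz <= T + e%:R * (2 * C * s ^+ 2).
  have -> : T + e%:R * (2 * C * s ^+ 2) =
      \sum_(j < e) (gapval e.+1 c j + s * g j + 2 * C * s ^+ 2).
    rewrite !big_split /= -mulr_sumr sumg mulr0 addr0 sumr_const card_ord.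
    by rewrite mulr_natl.
  apply: ler_sum => j _; have := gap s j s01 (ltn_ord j).
  by rewrite ler_norml => /andP[_]; lra.
have : gapval e.+1 c i + s * g i - 2 * C * s ^+ 2 <= gapval e.+1 (z s) i.
  by have := gap s i s01 ie; rewrite ler_norml => /andP[]; lra.
apply: le_trans.
(* The right side is the convex combination of the old oscillation and the proportional one with
   weights [1 - s] and [s]; they satisfy the bound with [t] and [t + gam] respectively. *)
have lo : i.+1%:R * T * (t + s * gam) <= gapval e.+1 c i + s * g i.
  rewrite /g /gam.
  have := ct i ie; rewrite -/T; set A := gapval _ _ i; set w := i.+1%:R.
  move=> ctA; have : (1 - s) * (t * w * T) <= (1 - s) * A.
    by rewrite ler_wpM2l // subr_ge0.
  set v := (weight_sum e)^-1; lra.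
have w1 : 1 <= i.+1%:R :> R by rewrite ler1n.
set w := i.+1%:R in lo w1 *.
have tz0 : 0 <= (t + s * gam / 2) * w.
  rewrite mulr_ge0 // ?addr_ge0 ?divr_ge0 ?mulr_ge0 // ?ltW //; exact: lt_le_trans w1.
apply: le_trans (ler_wpM2l tz0 TzT) _.
have key : w * s * (s * M) <= w * s * (T * gam / 2).
  by rewrite ler_wpM2l // mulr_ge0 ?(le_trans ler01 w1) // ltW.
have sg : s * gam / 2 <= gam by rewrite ler_pdivrMr // mulrC ler_pM2l //; lra.
have k2 : (t + s * gam / 2) * w * (e%:R * (2 * C * s ^+ 2)) <=
    (t + gam) * w * (e%:R * (2 * C * s ^+ 2)).
  apply: ler_wpM2r; first by rewrite mulr_ge0 // mulr_ge0 ?sqr_ge0 // mulr_ge0.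
  by rewrite ler_wpM2r ?(le_trans ler01 w1) // lerD2l.
have k3 : 2 * C * s ^+ 2 <= w * (2 * C * s ^+ 2).
  by rewrite ler_peMl // mulr_ge0 ?sqr_ge0 // mulr_ge0.
rewrite /M in key; lra.
Qed.

Lemma eq_gapval e c c' i : (forall j, (j <= e)%N -> c j = c' j) -> (i < e)%N ->
  gapval e.+1 c i = gapval e.+1 c' i.
Proof.
move=> cc ie; rewrite /gapval !cc // 1?ltnW //.
have -> // : crit_poly e.+1 c = crit_poly e.+1 c'.
by apply: eq_bigr => j _; rewrite cc // -ltnS.
Qed.

Lemma eq_slack e c c' t : (forall j, (j <= e)%N -> c j = c' j) ->
  slack e c t -> slack e c' t.
Proof.
move=> cc ct i ie; rewrite -(eq_gapval cc) //.
under eq_bigr do rewrite -(eq_gapval cc) //.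
exact: ct.
Qed.

Lemma closed_nneg (T : topologicalType) (g : T -> R) :
  continuous g -> closed [set v | 0 <= g v].
Proof.
by move=> gc; apply: (@closed_comp _ _ g [set x | 0 <= x]) => [v _|]; [exact: gc|exact: closed_ge].
Qed.

Lemma closed_slack_set (T : topologicalType) (cf : T -> nat -> R) (tf : T -> R) e :
  (forall j, continuous (cf^~ j)) -> continuous tf ->
  closed ([set v | 0 <= - cf v 0%N] `&` ([set v | 0 <= cf v e - 1] `&`
    (\bigcap_(i in [set i | (i < e)%N]) [set v | 0 <= cf v i.+1 - cf v i] `&`
     \bigcap_(i in [set i | (i < e)%N]) [set v | 0 <=
      gapval e.+1 (cf v) i - tf v * i.+1%:R * (\sum_(j < e) gapval e.+1 (cf v) j)]))).
Proof.
move=> cf_cont tf_cont.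
apply: closedI; first by apply: closed_nneg => v; apply: cvgN; exact: cf_cont.
apply: closedI.
  by apply: closed_nneg => v; apply: cvgB; [exact: cf_cont|exact: cvg_cst].
apply: closedI; apply: closed_bigI => i _; apply: closed_nneg => v.
  by apply: cvgB; exact: cf_cont.
apply: cvgB; first exact: continuous_gapval.
apply: cvgM; first by apply: cvgM; [exact: tf_cont|exact: cvg_cst].
by apply: continuous_bigsum => j; exact: continuous_gapval.
Qed.

(** [slack] is invariant under affine maps with positive scale, so the nodes may be normalised to
    run from 0 to 1. The admissible pairs [(c, t)] with [t >= 0] then form a compact set. *)
Lemma slack_max e : (0 < e)%N -> exists c, exists2 t : R,
  [/\ mono_upto e c, c 0%N = 0, c e = 1, 0 < t & slack e c t] &
  forall z t', mono_upto e z -> z 0%N < z e -> slack e z t' -> t' <= t.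
Proof.
move=> e0.
(* Coordinates 0 to [e] of the vector store the nodes, the last one stores [t]. *)
pose cf (v : 'rV[R]_e.+2) (j : nat) : R := v 0 (inord j).
pose tf (v : 'rV[R]_e.+2) : R := v 0 ord_max.
have cf_cont j : continuous (cf^~ j) by move=> v; exact: coord_continuous.
have tf_cont : continuous tf by move=> v; exact: coord_continuous.
pose box := [set v : 'rV[R]_e.+2 | forall i, `[0, 1]%classic (v ord0 i)].
pose S2 := [set v | 0 <= - cf v 0%N].
pose S3 := [set v | 0 <= cf v e - 1].
pose S1 := \bigcap_(i in [set i | (i < e)%N]) [set v | 0 <= cf v i.+1 - cf v i].
pose S4 := \bigcap_(i in [set i | (i < e)%N])
  [set v | 0 <= gapval e.+1 (cf v) i - tf v * i.+1%:R * (\sum_(j < e) gapval e.+1 (cf v) j)].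
pose K := box `&` (S2 `&` (S3 `&` (S1 `&` S4))).
have Kc : compact K.
  apply: compact_closedI; first by
    apply: (@rV_compact R e.+2 (fun=> `[(0 : R), 1]%classic)) => i; exact: segment_compact.
  exact: closed_slack_set.
have KP v : K v -> [/\ mono_upto e (cf v), cf v 0%N = 0, cf v e = 1 & slack e (cf v) (tf v)].
  move=> [vb [v2 [v3 [v1 v4]]]]; split.
  - by apply: mono_uptoP => i ie; have := v1 i ie; rewrite /= subr_ge0.
  - apply/eqP; rewrite eq_le; move: v2; rewrite /S2 /= oppr_ge0 => -> /=.
    by have := vb (inord 0); rewrite /= in_itv => /andP[].
  - apply/eqP; rewrite eq_le; move: v3; rewrite /S3 /= subr_ge0 => ->; rewrite andbT.
    by have := vb (inord e); rewrite /= in_itv => /andP[].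
  - by move=> i ie; have := v4 i ie; rewrite /= subr_ge0.
have inK z t' : 0 <= t' -> mono_upto e z -> z 0%N < z e -> slack e z t' ->
    exists2 v, K v & tf v = t'.
  move=> t'0 zm z0e zt; pose L := z e - z 0%N; have L0 : 0 < L by rewrite subr_gt0.
  have t'1 : t' <= 1.
    have := slack_le zm z0e zt; have := weight_sum_ge1 e0.
    set w := weight_sum e => w1 tw1.
    by apply: le_trans tw1; rewrite -[X in X <= _]mulr1 ler_wpM2l.
  pose c' j := (z j - z 0%N) / L.
  have c'm : mono_upto e c'.
    by move=> j k jk; rewrite ler_pM2r ?invr_gt0 // lerD2r; exact: zm.
  have c'0 : c' 0%N = 0 by rewrite /c' subrr mul0r.
  have c'e : c' e = 1 by rewrite /c' divff // gt_eqF.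
  pose v : 'rV[R]_e.+2 := \row_i (if (i : nat) == e.+1 then t' else c' i).
  have cfv j : (j <= e)%N -> c' j = cf v j.
    move=> je; rewrite /cf mxE inordK; last by rewrite ltnS (leq_trans je).
    by rewrite ltn_eqF.
  have tfv : tf v = t' by rewrite /tf mxE /= eqxx.
  have st : slack e (cf v) t' by apply: (eq_slack cfv); exact: slack_affine.
  exists v => //; split; [|split; [|split; [|split]]].
  - move=> i; rewrite /= in_itv mxE; case: eqP => [_|ine]; first by rewrite /= t'0.
    have ie : (i <= e)%N by have := ltn_ord i; rewrite ltnS leq_eqVlt => /orP[/eqP|].
    by apply/andP; split; [rewrite -c'0|rewrite -c'e]; apply: c'm; rewrite ?ie ?leqnn.
  - by rewrite /S2 /= -cfv // c'0 oppr0.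
  - by rewrite /S3 /= -cfv // c'e subrr.
  - by move=> i ie; rewrite /= -!cfv // 1?ltnW // subr_ge0; apply: c'm; rewrite leqnSn.
  - by move=> i ie; rewrite /= subr_ge0 tfv; exact: st.
(* Equidistant nodes have positive oscillations; they show that the maximum is positive. *)
have [t0 t0p t0s] : exists2 t0 : R, 0 < t0 & slack e (fun j => j%:R) t0.
  pose c j : R := j%:R.
  have cm : mono_upto e c by move=> j k /andP[jk _]; rewrite ler_nat.
  have cs i : (i < e)%N -> 0 < gapval e.+1 c i.
    by move=> ie; apply: gapval_gt0 => //; rewrite ltr_nat.
  have T0 : 0 < \sum_(j < e) gapval e.+1 c j by apply: sum_gapval_gt0 => //; rewrite ltr_nat.
  have [|t tp tl] := @exists_pos_lb R e
    (fun i => gapval e.+1 c i / (i.+1%:R * \sum_(j < e) gapval e.+1 c j)).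
    by move=> i ie; rewrite divr_gt0 ?cs // mulr_gt0.
  exists t => // i ie; have := tl i ie.
  by rewrite ler_pdivlMr ?mulr_gt0 // mulrA.
have nm : mono_upto e (fun j => j%:R : R) by move=> j k /andP[jk _]; rewrite ler_nat.
have ne : 0%:R < e%:R :> R by rewrite ltr_nat.
have [v0 Kv0 tv0] := inK _ _ (ltW t0p) nm ne t0s.
have [v vK vmax] : exists2 v, v \in K & forall w, w \in K -> tf w <= tf v.
  apply: compact_EVT_max => //; first by exists v0.
  exact: continuous_subspaceT.
have [vm v0E veE vs] := KP v (set_mem vK).
have tp : 0 < tf v by apply: lt_le_trans t0p _; rewrite -tv0 vmax // mem_set.
exists (cf v), (tf v) => // z t' zm z0e zt.
have [t'0|/ltW t'0] := leP t' 0; first by apply: le_trans t'0 (ltW tp).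
by have [w Kw <-] := inK z t' t'0 zm z0e zt; apply: vmax; exact: mem_set.
Qed.

(* The critical values come out as [b, b - k, b + k, b - 2k, b + 2k, ...], which
   is a permutation of an arithmetic progression of step [k]. *)
Lemma equispaced_critical_values e : (0 < e)%N ->
  exists (p : {poly R}) (a k : R),
    [/\ (size p <= e.+3)%N, 0 < k, p^`() != 0, root p^`() 0 &
     forall j, (j <= e)%N -> exists2 x, root p^`() x & p.[x] = a + k * j%:R].
Proof.
move=> e0; have [c [t [cm c0 ce tp ct] tmax]] := slack_max e0.
have c0e : c 0%N < c e by rewrite c0 ce.
set T := \sum_(j < e) gapval e.+1 c j.
have T0 : 0 < T by exact: sum_gapval_gt0.
have tw : t * weight_sum e = 1.
  apply/eqP; rewrite eq_le (slack_le cm c0e ct) leNgt /=; apply/negP => tw.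
  have [z [t' [zm z0e zt] tt']] := slack_improve e0 tp cm c0e ct tw.
  by have := tmax z t' zm z0e zt; rewrite leNgt tt'.
have gE i : (i < e)%N -> gapval e.+1 c i = t * T * i.+1%:R.
  move=> ie; apply/eqP; rewrite -subr_eq0; apply/eqP.
  have nn (j : 'I_e) : true -> 0 <= gapval e.+1 c j - t * T * j.+1%:R.
    by move=> _; rewrite subr_ge0 mulrAC; exact: ct.
  (* Nonnegative differences with sum 0 vanish one by one. *)
  have /(psumr_eq0P nn) : \sum_(j < e) (gapval e.+1 c j - t * T * j.+1%:R) = 0.
    by rewrite sumrB -/T -mulr_sumr -/(weight_sum e) mulrAC tw mul1r subrr.
  by move/(_ (Ordinal ie) isT).
set p := primitive (crit_poly e.+1 c); set k := t * T.
have k0 : 0 < k by exact: mulr_gt0.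
have step i : (i < e)%N -> p.[c i.+1] = p.[c i] - (-1) ^+ i * (k * i.+1%:R).
  move=> ie; rewrite -gE // /gapval -/p mulrA -exprD addnn -mul2n exprM sqrrN !expr1n.
  by rewrite mul1r subKr.
have vals n : ((2 * n <= e)%N -> p.[c (2 * n)%N] = p.[c 0%N] + k * n%:R) /\
    ((2 * n < e)%N -> p.[c (2 * n).+1] = p.[c 0%N] - k * n.+1%:R).
  have odd_of_even : ((2 * n <= e)%N -> p.[c (2 * n)%N] = p.[c 0%N] + k * n%:R) ->
      ((2 * n < e)%N -> p.[c (2 * n).+1] = p.[c 0%N] - k * n.+1%:R).
    move=> ev ne; rewrite step // ev 1?ltnW // exprM sqrrN !expr1n mul1r.
    by rewrite -[(2 * n).+1%:R]natr1 -[n.+1%:R]natr1 natrM; ring.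
  suff ev : (2 * n <= e)%N -> p.[c (2 * n)%N] = p.[c 0%N] + k * n%:R.
    by split => //; exact: odd_of_even.
  elim: n {odd_of_even} => [_|n IH]; first by rewrite muln0 mulr0 addr0.
  rewrite mulnS !add2n => ne; rewrite step // step 1?ltnW // IH 1?ltnW 1?ltnW //.
  rewrite exprS exprM sqrrN !expr1n -[(2 * n).+2%:R]natr1 -[(2 * n).+1%:R]natr1.
  by rewrite -[n.+1%:R]natr1 natrM; ring.
have rootp i : (i <= e)%N -> root p^`() (c i).
  by move=> ie; rewrite /p deriv_primitive rootE crit_poly_root.
(* There are [uphalf e] odd indices up to [e], and each gives a level below [p.[c 0]]; hence the
   lowest critical value is this one. *)
exists p, (p.[c 0%N] - k * (uphalf e)%:R), k; split => //.
- apply: leq_trans (size_primitive _) _; rewrite ltnS.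
  by have := size_coef_pencil e.+1 c c 0; rewrite coef0_pencil subn0.
- apply/eqP => p0; have : p^`().[-1] = 0 by rewrite p0 horner0.
  rewrite /p deriv_primitive crit_poly_horner => /eqP; rewrite gt_eqF //.
  apply: prodr_gt0 => j _; rewrite opprK ltr_wpDl // -c0; apply: cm.
  by have := ltn_ord j; rewrite ltnS.
- by rewrite -c0; exact: rootp.
- move=> j je; have [jh|hj] := ltnP j (uphalf e).
    have lt : (2 * (uphalf e - j.+1) < e)%N by move: jh; rewrite uphalfE; lia.
    exists (c (2 * (uphalf e - j.+1)).+1); first exact: rootp.
    rewrite (vals _).2 // -subSn // subSS natrB 1?ltnW //; ring.
  have le : (2 * (j - uphalf e) <= e)%N by move: hj; rewrite uphalfE; lia.
  exists (c (2 * (j - uphalf e))%N); first exact: rootp.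
  by rewrite (vals _).1 // natrB //; ring.
Qed.

End EquispacedCriticalValues.

(** * Maps given by a series of one-variable polynomials *)

Section PolynomialBounds.
Context {R : realType}.
Implicit Types (s t M w : R) (g : {poly R}).

Lemma norm_expr_le t M l d : `|t| <= M -> 1 <= M -> (l <= d)%N -> `|t ^+ l| <= M ^+ d.
Proof.
move=> tM M1 ld; rewrite normrX; apply: (@le_trans _ _ (M ^+ l)).
  by rewrite lerXn2r ?nnegrE // (le_trans _ M1).
by rewrite ler_weXn2l.
Qed.

Lemma norm_subrXX_le s t M l : `|s| <= M -> `|t| <= M -> 1 <= M ->
  `|s ^+ l - t ^+ l| <= l%:R * M ^+ l * `|s - t|.
Proof.
move=> sM tM M1; elim: l => [|l IH]; first by rewrite !expr0 subrr normr0 !mul0r.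
have -> : s ^+ l.+1 - t ^+ l.+1 = s * (s ^+ l - t ^+ l) + t ^+ l * (s - t).
  by rewrite !exprS; ring.
apply: le_trans (ler_normD _ _) _; rewrite !normrM.
have M0 : 0 <= M by exact: le_trans M1.
have a1 : `|s| * `|s ^+ l - t ^+ l| <= M * (l%:R * M ^+ l * `|s - t|) by exact: ler_pM.
have a2 : `|t ^+ l| * `|s - t| <= M ^+ l.+1 * `|s - t|.
  by rewrite ler_wpM2r // norm_expr_le.
by apply: le_trans (lerD a1 a2) _; rewrite -natr1 exprS; lra.
Qed.

Lemma norm_taylor_expr_le s t M l : `|s| <= M -> `|t| <= M -> 1 <= M ->
  `|s ^+ l - t ^+ l - (t ^+ l.-1 *+ l) * (s - t)| <= l%:R ^+ 2 * M ^+ l * (s - t) ^+ 2.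
Proof.
move=> sM tM M1; elim: l => [|l IH].
  by rewrite !expr0 subrr mulr0n mul0r subrr normr0 expr0n !mul0r.
have -> : s ^+ l.+1 - t ^+ l.+1 - (t ^+ l *+ l.+1) * (s - t) =
    s * (s ^+ l - t ^+ l - (t ^+ l.-1 *+ l) * (s - t)) + (t ^+ l.-1 *+ l) * (s - t) ^+ 2.
  rewrite mulrSr; case: l {IH} => [|l]; first by rewrite !mulr0n; ring.
  by rewrite /= -[t ^+ l.+1 *+ _]mulr_natr -[t ^+ l *+ _]mulr_natr !exprS; ring.
apply: le_trans (ler_normD _ _) _; rewrite normrM [X in _ + X]normrM.
have M0 : 0 <= M by exact: le_trans M1.
rewrite [`|(s - t) ^+ 2|]ger0_norm ?sqr_ge0 //.
have a1 : `|s| * `|s ^+ l - t ^+ l - (t ^+ l.-1 *+ l) * (s - t)| <=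
    M * (l%:R ^+ 2 * M ^+ l * (s - t) ^+ 2) by exact: ler_pM.
have a2 : `|t ^+ l.-1 *+ l| * (s - t) ^+ 2 <= l%:R * M ^+ l.+1 * (s - t) ^+ 2.
  rewrite ler_wpM2r ?sqr_ge0 // normrMn -[X in X <= _]mulr_natl ler_wpM2l //.
  by rewrite norm_expr_le // (leq_trans (leq_pred _)).
apply: le_trans (lerD a1 a2) _.
have q0 : 0 <= (s - t) ^+ 2 by exact: sqr_ge0.
have b0 : 0 <= M ^+ l.+1 * (s - t) ^+ 2 by rewrite mulr_ge0 // exprn_ge0.
have l0 : 0 <= l%:R :> R by [].
rewrite -natr1 exprS; move: b0; rewrite exprS; set A := M * M ^+ l; set q := (s - t) ^+ 2.
rewrite (_ : M * (_ * _ * q) = l%:R ^+ 2 * (A * q)); last by rewrite /A; ring.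
by move=> b0; nra.
Qed.

(** One crude constant for the value, the derivative, its Lipschitz constant and the Taylor
    remainder on [[-M, M]]: [d + 1] monomials, each costing at most [(d + 1)^2 M^d]. *)
Definition pbound d M : R := d.+1%:R * (d.+1%:R ^+ 2 * M ^+ d).

Lemma pbound_ge0 d M : 1 <= M -> 0 <= pbound d M.
Proof. by move=> M1; rewrite !mulr_ge0 // exprn_ge0 // (le_trans _ M1). Qed.

Lemma poly_sum_le d g w (A : nat -> R) B : (forall l, `|g`_l| <= w) ->
  (forall l, (l <= d)%N -> `|A l| <= B) ->
  `|\sum_(l < d.+1) g`_l * A l| <= w * (d.+1%:R * B).
Proof.
move=> gw AB; apply: le_trans (ler_norm_sum _ _ _) _.
have -> : w * (d.+1%:R * B) = \sum_(l < d.+1) w * B.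
  by rewrite sumr_const card_ord -mulr_natl; ring.
apply: ler_sum => l _; rewrite normrM ler_pM //; apply: AB.
by rewrite -ltnS.
Qed.

Section OnePoly.
Variables (d : nat) (g : {poly R}) (w M : R).
Hypotheses (sg : (size g <= d.+1)%N) (gw : forall l, `|g`_l| <= w) (M1 : 1 <= M).

Lemma horner_wide t : g.[t] = \sum_(l < d.+1) g`_l * t ^+ l.
Proof. exact: horner_coef_wide. Qed.

Lemma horner_deriv_wide t : g^`().[t] = \sum_(l < d.+1) g`_l * (t ^+ l.-1 *+ l).
Proof.
have -> : g = \sum_(l < d.+1) g`_l *: 'X^l.
  rewrite -(poly_def d.+1 (fun l => g`_l)); apply/polyP => l; rewrite coef_poly.
  by case: ltnP => // dl; rewrite nth_default // (leq_trans sg).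
rewrite raddf_sum horner_sum; apply: eq_bigr => l _ /=.
rewrite derivZ derivXn hornerZ hornerMn hornerXn; congr (_ * _).
by rewrite -(poly_def d.+1 (fun l => g`_l)) coef_poly ltn_ord.
Qed.

Let M0 : 0 <= M. Proof. exact: le_trans M1. Qed.
Let D1 : 1 <= d.+1%:R :> R. Proof. by rewrite ler1n. Qed.

Let lM l : (l <= d)%N -> l%:R * M ^+ l <= d.+1%:R ^+ 2 * M ^+ d.
Proof.
move=> ld; apply: ler_pM => //; first exact: exprn_ge0.
  apply: (@le_trans _ _ d.+1%:R); first by rewrite ler_nat ltnW.
  by rewrite expr2 ler_peMl.
by rewrite ler_weXn2l.
Qed.

Let l2M l : (l <= d)%N -> l%:R ^+ 2 * M ^+ l <= d.+1%:R ^+ 2 * M ^+ d.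
Proof.
move=> ld; apply: ler_pM => //; try exact: exprn_ge0.
  by rewrite lerXn2r ?nnegrE // ler_nat ltnW.
by rewrite ler_weXn2l.
Qed.

Lemma poly_horner_le t : `|t| <= M -> `|g.[t]| <= w * pbound d M.
Proof.
move=> tM; rewrite horner_wide; apply: (poly_sum_le (A := fun l => t ^+ l)) => // l ld.
apply: le_trans (norm_expr_le tM M1 ld) _.
by rewrite ler_peMl ?exprn_ge0 // expr2 mulr_ege1.
Qed.

Lemma poly_deriv_le t : `|t| <= M -> `|g^`().[t]| <= w * pbound d M.
Proof.
move=> tM; rewrite horner_deriv_wide.
apply: (poly_sum_le (A := fun l => t ^+ l.-1 *+ l)) => // l ld.
rewrite normrMn -[X in X <= _]mulr_natl; apply: le_trans (lM ld).
by rewrite ler_wpM2l // norm_expr_le // leq_pred.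
Qed.

Lemma poly_deriv_lip s t : `|s| <= M -> `|t| <= M ->
  `|g^`().[s] - g^`().[t]| <= w * pbound d M * `|s - t|.
Proof.
move=> sM tM; rewrite !horner_deriv_wide -sumrB.
under eq_bigr do rewrite -mulrBr.
rewrite -mulrA /pbound -mulrA.
apply: (poly_sum_le (A := fun l => s ^+ l.-1 *+ l - t ^+ l.-1 *+ l)) => // l ld.
rewrite -mulrnBl normrMn -[X in X <= _]mulr_natl.
apply: (@le_trans _ _ (l%:R * (l%:R * M ^+ l * `|s - t|))).
  rewrite ler_wpM2l //; apply: le_trans (norm_subrXX_le _ sM tM M1) _.
  rewrite ler_wpM2r // ler_pM ?exprn_ge0 // ?ler_nat ?leq_pred //.
  by rewrite ler_weXn2l ?leq_pred.
by rewrite !mulrA -expr2 ler_wpM2r // l2M.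
Qed.

Lemma poly_taylor_le s t : `|s| <= M -> `|t| <= M ->
  `|g.[s] - g.[t] - g^`().[t] * (s - t)| <= w * pbound d M * (s - t) ^+ 2.
Proof.
move=> sM tM; rewrite !horner_wide horner_deriv_wide mulr_suml -!sumrB.
have E (l : 'I_d.+1) : true -> g`_l * s ^+ l - g`_l * t ^+ l - g`_l * (t ^+ l.-1 *+ l) * (s - t) =
  g`_l * (s ^+ l - t ^+ l - (t ^+ l.-1 *+ l) * (s - t)) by move=> _; ring.
rewrite (eq_bigr _ E) -mulrA /pbound -mulrA.
apply: (poly_sum_le (A := fun l => s ^+ l - t ^+ l - (t ^+ l.-1 *+ l) * (s - t))) => // l ld.
apply: le_trans (norm_taylor_expr_le _ sM tM M1) _.
by rewrite ler_wpM2r ?sqr_ge0 // l2M.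
Qed.

End OnePoly.
End PolynomialBounds.

Section SeriesLimits.
Context {R : realType}.

Lemma lsum_tail (w : nat -> R) (e : R) : asummable w -> 0 < e ->
  exists N, lsum (fun k => if (k < N)%N then 0 else w k) < e.
Proof.
move=> sw e0; have /cvgrPdist_lt/(_ e e0) [N _ HN] := asummable_cvg sw.
exists N; have := HN N (leqnn N); rewrite /= -/(lsum w) (lsum_split N sw).
rewrite /series /= big_mkord (eq_bigr (fun k : 'I_N => w k)) => [|k _].
  by rewrite addrAC subrr add0r; exact/le_lt_trans/ler_norm.
by rewrite ltn_ord.
Qed.

(* Tannery's theorem *)
Lemma lsum_dominated_cvg0 (a : nat -> nat -> R) (w : nat -> R) : asummable w ->
  (forall n k, `|a n k| <= w k) -> (forall k, (fun n => a n k) @ \oo --> 0) ->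
  (fun n => lsum (a n)) @ \oo --> 0.
Proof.
move=> sw aw a0; apply/cvgr0Pnorm_lt => e e0.
have e20 : 0 < e / 2 by rewrite divr_gt0.
have [N tail] := lsum_tail sw e20.
have fin : (fun n => \sum_(k < N) a n k) @ \oo --> \sum_(k < N) (0 : R).
  by apply: cvg_big => [|k _]; [exact: add_continuous|exact: a0].
rewrite big1 // in fin; have := fin; move/cvgr0Pnorm_lt => /(_ _ e20); apply: filterS => n Hn.
have san : asummable (a n) by exact: asummable_le (aw n) sw.
rewrite (lsum_split N san) (eq_bigr (fun k : 'I_N => a n k)) => [|k _]; last by rewrite ltn_ord.
apply: le_lt_trans (ler_normD _ _) _.
rewrite [e]splitr ltrD //; apply: le_lt_trans tail; apply: norm_lsum_le => [k|].
  by case: ifP; rewrite ?normr0.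
apply: (asummable_le _ sw) => k; have wk : 0 <= w k by exact: le_trans (aw n k).
by case: ifP => _; rewrite ?normr0 // ger0_norm.
Qed.

Lemma asummable_sum (I : Type) (r : seq I) (P : pred I) (F : I -> nat -> R) :
  (forall i, P i -> asummable (F i)) ->
  asummable (fun n => \sum_(i <- r | P i) F i n).
Proof.
move=> sF; elim: r => [|i r IH].
  by under eq_fun do rewrite big_nil; exact: asummable0.
under eq_fun do rewrite big_cons.
by case E: (P i) => //; apply: asummableD => //; exact: sF.
Qed.

Lemma lsum_sum (I : Type) (r : seq I) (P : pred I) (F : I -> nat -> R) :
  (forall i, P i -> asummable (F i)) ->
  lsum (fun n => \sum_(i <- r | P i) F i n) = \sum_(i <- r | P i) lsum (F i).
Proof.
move=> sF; elim: r => [|i r IH].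
  by under eq_fun do rewrite big_nil; rewrite big_nil lsum0.
under eq_fun do rewrite big_cons.
rewrite big_cons; case E: (P i) => //; rewrite lsumD ?IH //; first exact: sF.
exact: asummable_sum.
Qed.

End SeriesLimits.

Section Multinomial.
Context {R : realType}.

(** Expand the power over all maps from factors to summands and group the maps by their fibre sizes.
    These are at most [l <= d], so they fit in ['I_d.+1]. *)
Lemma multinomial_expand (k d l : nat) : (l <= d)%N ->
  exists M : {ffun 'I_k -> 'I_d.+1} -> R, forall s : 'I_k -> R,
    (\sum_i s i) ^+ l =
    \sum_(a : {ffun 'I_k -> 'I_d.+1} | (\sum_(i < k) (a i : nat) == l)%N)
      M a * \prod_(i < k) s i ^+ a i.
Proof.
move=> ld.
pose cnt (phi : {ffun 'I_l -> 'I_k}) : {ffun 'I_k -> 'I_d.+1} :=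
  [ffun i => inord #|[pred j | phi j == i]|].
have cntE phi i : cnt phi i = #|[pred j | phi j == i]| :> nat.
  rewrite ffunE inordK // ltnS (leq_trans _ ld) // -[X in (_ <= X)%N]card_ord.
  exact: max_card.
exists (fun a => #|[pred phi | cnt phi == a]|%:R) => s.
rewrite -[l in LHS]card_ord -prodr_const bigA_distr_bigA /=.
rewrite (partition_big cnt (fun a => (\sum_(i < k) (a i : nat) == l)%N)) /=; last first.
  move=> phi _; apply/eqP; under eq_bigr do rewrite cntE -sum1_card.
  rewrite -[RHS]card_ord -[in RHS]sum1_card (partition_big phi xpredT) //=.
apply: eq_bigr => a _; rewrite mulr_natl -sumr_const.
apply: eq_bigr => phi /eqP <-.
rewrite (partition_big phi xpredT) //=; apply: eq_bigr => i _.
by rewrite cntE -prodr_const; apply: eq_bigr => j /eqP ->.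
Qed.

End Multinomial.

Section L2Basis.
Context {R : realType}.

Definition l2_delta (n : nat) : l2 R.
Proof.
apply: (@l2_of R (fun k => if k == n then 1 else 0)).
by apply: (@asummable_fin _ _ n.+1) => k nk; rewrite gtn_eqF // expr0n.
Defined.

Lemma l2_deltaE n k : l2_delta n k = if k == n then 1 else 0.
Proof. by []. Qed.

Lemma l2_inner_delta x n : l2_inner x (l2_delta n) = x n.
Proof.
rewrite /l2_inner (@lsum_fin _ _ n.+1) => [|k nk]; last by rewrite l2_deltaE gtn_eqF // mulr0.
rewrite big_ord_recr /= l2_deltaE eqxx mulr1 big1 ?add0r // => k _.
by rewrite l2_deltaE ltn_eqF // mulr0.
Qed.

Lemma l2_norm_delta n : `|l2_delta n| = 1.
Proof.
apply/eqP; rewrite -(@eqrXn2 _ 2) // expr1n l2_normE l2_inner_delta l2_deltaE eqxx //.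
Qed.

Lemma l2_inner_norm_le (x y : l2 R) : `|l2_inner x y| <= `|x| * `|y|.
Proof.
rewrite -(@ler_pXn2r _ 2) ?nnegrE ?mulr_ge0 // real_normK ?num_real // exprMn !l2_normE.
exact: l2_cauchy_schwarz.
Qed.

End L2Basis.

(** * Diagonal series of polynomials on l2 belong to the polynomial class *)

Section DiagonalMaps.
Context {R : realType} {m : nat}.

Lemma rV_norm_le (v : 'rV[R]_m) (c : R) : 0 <= c ->
  (forall j, `|v 0 j| <= c) -> `|v| <= c.
Proof.
move=> c0 vc; rewrite [X in X <= _]/Num.norm /= mx_normrE; apply: bigmax_le => // -[i j] _ /=.
by rewrite [i]ord1.
Qed.

Lemma quadratic_remainder_diff (V W : normedModType R) (f : V -> W)
    (df : {linear V -> W}) (x : V) (C : R) : continuous df -> 0 <= C ->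
  (forall h, `|h| <= 1 -> `|f (h + x) - f x - df h| <= C * `|h| ^+ 2) ->
  differentiable f x /\ 'd f x = df :> (V -> W).
Proof.
move=> dfc C0 fC.
have o : f \o shift x = cst (f x) + df +o_ 0 id.
  apply/eqaddoP => e e0.
  have r0 : 0 < Num.min 1 (e / (C + 1)) by rewrite lt_min ltr01 divr_gt0 // ltr_wpDl.
  near=> h.
  have hr : `|h| < Num.min 1 (e / (C + 1)).
    by near: h; have := nbhs0_lt r0; apply.
  move: hr; rewrite lt_min => /andP[h1 he].
  rewrite /= !fctE opprD addrA; apply: le_trans (fC h (ltW h1)) _.
  rewrite expr2 mulrA ler_wpM2r //.
  move: he; rewrite ltr_pdivlMr ?ltr_wpDl // => he.
  by have := normr_ge0 h; nra.
have E : 'd f x = df :> (V -> W) by exact: diff_unique.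
by split => //; apply/diff_locallyP; rewrite E.
Unshelve. all: by end_near. Qed.

Lemma bounded_op_continuous (V W : normedModType R) (df : {linear V -> W}) (C : R) :
  (forall v, `|df v| <= C * `|v|) -> continuous df.
Proof.
move=> dfC; apply: bounded_linear_continuous; apply/linear_boundedP.
exists C; split; first exact: num_real.
by move=> c Cc v; apply: le_trans (dfC v) _; rewrite ler_wpM2r // ltW.
Qed.

Variables (d : nat) (G : 'I_m -> nat -> {poly R}) (w : nat -> R).
Hypothesis w_sum : asummable w.
Hypothesis G_size : forall j k, (size (G j k) <= d.+1)%N.
Hypothesis G_coef : forall j k l, `|(G j k)`_l| <= w k.

Definition diag_map (x : l2 R) : 'rV[R]_m := \row_j lsum (fun k => (G j k).[x k]).

Definition diag_diff (x v : l2 R) : 'rV[R]_m :=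
  \row_j lsum (fun k => (G j k)^`().[x k] * v k).

Lemma w_ge0 (j : 'I_m) k : 0 <= w k.
Proof. exact: le_trans (G_coef j k 0). Qed.

Lemma asummable_wZ (C : R) : asummable (fun k => w k * C).
Proof. by under eq_fun do rewrite mulrC; exact: asummableZ. Qed.

Lemma lsum_wZ (C : R) : lsum (fun k => w k * C) = lsum w * C.
Proof. by under eq_fun do rewrite mulrC; rewrite lsumZ // mulrC. Qed.

Let rad (x : l2 R) : R := `|x| + 1.
Let rad_ge1 x : 1 <= rad x. Proof. by rewrite lerDr. Qed.
Let rad_coord (x : l2 R) k : `|x k| <= rad x.
Proof. by apply: le_trans (l2_coord_norm x k) _; rewrite lerDl. Qed.

Lemma asummable_diag j (x : l2 R) : asummable (fun k => (G j k).[x k]).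
Proof.
apply: (asummable_le _ (asummable_wZ (pbound d (rad x)))) => k.
exact: (poly_horner_le (G_size j k) (G_coef j k) (rad_ge1 x) (rad_coord x k)).
Qed.

Lemma asummable_diag_diff j (x v : l2 R) : asummable (fun k => (G j k)^`().[x k] * v k).
Proof.
apply: (asummable_le _ (asummable_wZ (pbound d (rad x) * `|v|))) => k.
rewrite normrM mulrA ler_pM // ?l2_coord_norm //.
exact: (poly_deriv_le (G_size j k) (G_coef j k) (rad_ge1 x) (rad_coord x k)).
Qed.

Lemma diag_diff_is_linear x : linear (diag_diff x).
Proof.
move=> a u v; apply/rowP => j; rewrite !mxE.
have su := asummable_diag_diff j x u; have sv := asummable_diag_diff j x v.
rewrite -lsumZ // -lsumD //; last exact: asummableZ.
by congr lsum; apply/funext => k; rewrite l2D l2Z; ring.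
Qed.

Lemma lsum_w_ge0 (j : 'I_m) : 0 <= lsum w.
Proof. by apply: lsum_ge0 => // k; exact: w_ge0 j k. Qed.

Lemma diag_diff_bound x : exists2 C : R, 0 <= C & forall v, `|diag_diff x v| <= C * `|v|.
Proof.
(* For [m = 0] the coefficient bounds are vacuous and [lsum w] may be negative; the absolute value
   covers this case. *)
have C0 : 0 <= `|lsum w| * pbound d (rad x) by rewrite mulr_ge0 // pbound_ge0.
exists (`|lsum w| * pbound d (rad x)) => // v; apply: rV_norm_le => [|j].
  by rewrite mulr_ge0.
rewrite mxE [`|lsum w|]ger0_norm ?(lsum_w_ge0 j) // -mulrA -lsum_wZ.
apply: norm_lsum_le => [k|]; last exact: asummable_wZ.
 rewrite normrM mulrA ler_pM // ?l2_coord_norm //.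
exact: (poly_deriv_le (G_size j k) (G_coef j k) (rad_ge1 x) (rad_coord x k)).
Qed.

Lemma diag_map_diff x : differentiable diag_map x /\
  'd diag_map x = diag_diff x :> (l2 R -> 'rV[R]_m).
Proof.
have [C C0 HC] := diag_diff_bound x.
have M1 : 1 <= rad x + 1 by rewrite lerDr (le_trans _ (rad_ge1 x)).
have K0 : 0 <= `|lsum w| * pbound d (rad x + 1) by rewrite mulr_ge0 // pbound_ge0.
pose L : {linear l2 R -> 'rV[R]_m} :=
  HB.pack (diag_diff x) (GRing.isLinear.Build _ _ _ _ _ (diag_diff_is_linear x)).
apply: (@quadratic_remainder_diff _ _ _ L _ _ _ K0).
  exact: (bounded_op_continuous (df := L) HC).
move=> h h1; apply: rV_norm_le => [|j]; first by rewrite mulr_ge0 // sqr_ge0.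
have s1 := asummable_diag j (h + x); have s2 := asummable_diag j x.
have s3 := asummable_diag_diff j x h.
rewrite !mxE -lsumB // -lsumB //; last exact: asummableB.
rewrite [`|lsum w|]ger0_norm ?(lsum_w_ge0 j) // -mulrA -lsum_wZ.
apply: norm_lsum_le => [k|]; last exact: asummable_wZ.
 rewrite l2D.
have bx : `|x k| <= rad x + 1 by apply: le_trans (rad_coord x k) _; rewrite lerDl.
have bh : `|h k + x k| <= rad x + 1.
  apply: le_trans (ler_normD _ _) _; rewrite addrC lerD //.
  exact: le_trans (l2_coord_norm h k) _.
have := poly_taylor_le (G_size j k) (G_coef j k) M1 bh bx.
rewrite addrK => /le_trans; apply; rewrite mulrA ler_wpM2l //.
  by rewrite mulr_ge0 ?(w_ge0 j) // pbound_ge0.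
by rewrite -real_normK ?num_real // lerXn2r ?nnegrE // l2_coord_norm.
Qed.

Notation H := (l2_hilbert R).
Notation F := (diag_map : H -> 'rV[R]_m).

Definition deriv_gap j (x y : l2 R) : R :=
  lsum (fun k => `|(G j k)^`().[x k] - (G j k)^`().[y k]|).

Lemma deriv_gap_lip (M : R) j (x y : l2 R) k : 1 <= M -> `|x k| <= M -> `|y k| <= M ->
  `|(G j k)^`().[x k] - (G j k)^`().[y k]| <= w k * (pbound d M * `|x k - y k|).
Proof.
by move=> M1 xM yM; rewrite mulrA; exact: (poly_deriv_lip (G_size j k) (G_coef j k)).
Qed.

Lemma asummable_deriv_gap j (x y : l2 R) :
  asummable (fun k => `|(G j k)^`().[x k] - (G j k)^`().[y k]|).
Proof.
pose M := rad x + rad y.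
have r0 z : 0 <= rad z by exact: le_trans (rad_ge1 z).
have M1 : 1 <= M by rewrite (le_trans (rad_ge1 x)) // lerDl.
apply: (asummable_le _ (asummable_wZ (pbound d M * `|x - y|))) => k; rewrite normr_id.
apply: le_trans (@deriv_gap_lip M j x y k M1 _ _) _.
- by rewrite (le_trans (rad_coord x k)) // lerDl.
- by rewrite (le_trans (rad_coord y k)) // lerDr.
by rewrite ler_wpM2l ?(w_ge0 j) // ler_wpM2l ?pbound_ge0 // -l2B l2_coord_norm.
Qed.

Lemma deriv_gap_ge0 j x y : 0 <= deriv_gap j x y.
Proof. by apply: lsum_ge0 => //; exact: asummable_deriv_gap. Qed.

(** Coordinates of a vector in the unit ball are at most 1 in absolute value, so the l1 distance of
    the derivative sequences dominates the operator norm. Regularity of the differential thus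
    reduces to scalar series. *)
Lemma diag_Ddist_bound (x y : H) : 0 <= Ddist F x y <= \sum_j deriv_gap j x y.
Proof.
have S0 : 0 <= \sum_j deriv_gap j x y by rewrite sumr_ge0 // => j _; exact: deriv_gap_ge0.
have ub : ubound [set `|'d F x v - 'd F y v| | v in [set v : H | `|v| <= 1]]
    (\sum_j deriv_gap j x y).
  move=> _ [v v1 <-]; rewrite !(diag_map_diff _).2.
  apply: rV_norm_le => // j; rewrite !mxE -lsumB; try exact: asummable_diag_diff.
  apply: (@le_trans _ _ (deriv_gap j x y)); last first.
    by rewrite (bigD1 j) //= lerDl sumr_ge0 // => i _; exact: deriv_gap_ge0.
  apply: norm_lsum_le => [k|]; last exact: asummable_deriv_gap.
  rewrite -mulrBl normrM ler_piMr //.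
  by apply: le_trans (l2_coord_norm v k) v1.
have z1 : `|(0 : H)| <= 1 by rewrite normr0.
apply/andP; split; last by apply: ge_sup => //; eexists; exists (0 : H).
apply: (@le_trans _ _ `|'d F x 0 - 'd F y 0|) => //; apply: ub_le_sup.
  by exists (\sum_j deriv_gap j x y).
by exists (0 : H).
Qed.

Lemma diag_Ddist_lip (x : H) : exists2 L : R, 0 <= L &
  forall y z : H, `|y - x| < 1 -> `|z - x| < 1 -> Ddist F y z <= L * `|y - z|.
Proof.
pose M := rad x.
exists (\sum_(j < m) lsum w * pbound d M).
  by rewrite sumr_ge0 // => j _; rewrite mulr_ge0 ?(lsum_w_ge0 j) // pbound_ge0 // rad_ge1.
have close (y : l2 R) k : `|y - x| < 1 -> `|y k| <= M.
  move=> yx; apply: le_trans (l2_coord_norm y k) _.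
  rewrite -[y](subrK x) (le_trans (ler_normD _ _)) // addrC lerD2l ltW //.
move=> y z yx zx; have /andP[_] := diag_Ddist_bound y z.
move=> /le_trans; apply; rewrite mulr_suml; apply: ler_sum => j _.
rewrite -mulrA -lsum_wZ; apply: lsum_le; first exact: asummable_deriv_gap.
  exact: asummable_wZ.
move=> k; apply: le_trans (@deriv_gap_lip M j y z k (rad_ge1 x) (close _ _ yx) (close _ _ zx)) _.
rewrite ler_wpM2l ?(w_ge0 j) // ler_wpM2l ?pbound_ge0 ?rad_ge1 // -l2B.
exact: l2_coord_norm.
Qed.

(** Uniform boundedness applied to the functionals [l2_inner (u n)], evaluated at the basis
    vectors. *)
Lemma weak_cvg_coord_bounded (u : nat -> H) (x : H) : weak_cvg u x ->
  exists M : R, forall n k, `|(u n : l2 R) k| <= M.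
Proof.
move=> ux; pose Fam : set (l2 R -> R) := [set l2_inner (u n) | n in setT].
have lin f : Fam f -> bounded_fun_norm f /\ linear f.
  move=> [n _ <-]; split.
    move=> r; exists (`|u n| * r) => y yr; apply: le_trans (l2_inner_norm_le _ _) _.
    by rewrite ler_wpM2l.
  move=> a y z; rewrite l2_innerC l2_innerDl l2_innerZl.
  by rewrite [l2_inner y _]l2_innerC [l2_inner z _]l2_innerC.
have pb : pointwise_bounded Fam.
  move=> y; have /cvg_seq_bounded [M [_ HM]] : cvgn (fun n => l2_inner (u n) y).
    by apply/cvg_ex; exists (l2_inner x y); exact: (ux y).
  exists (M + 1) => f [n _ <-].
  by apply: (HM (M + 1)) => //; rewrite ltrDl.
have [M HM] := Banach_Steinhauss lin pb 1.
exists M => n k; rewrite -l2_inner_delta; apply: HM; first by exists n.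
by rewrite l2_norm_delta.
Qed.

(** Weak convergence gives convergence of each coordinate and a common bound [M]. The gaps of the
    derivatives are then dominated by a multiple of [w], and the limit passes through the series. *)
Lemma diag_Ddist_weak (u : nat -> H) (x : H) : weak_cvg u x ->
  (fun n => Ddist F (u n) x) @ \oo --> 0.
Proof.
move=> ux; have [M0 HM0] := weak_cvg_coord_bounded ux.
pose M := rad x + `|M0|.
have M1 : 1 <= M by rewrite (le_trans (rad_ge1 x)) // lerDl.
have uM n k : `|(u n : l2 R) k| <= M.
  apply: le_trans (HM0 n k) (le_trans (ler_norm _) _).
  by rewrite lerDr (le_trans _ (rad_ge1 x)).
have xM k : `|(x : l2 R) k| <= M.
  by apply: le_trans (rad_coord x k) _; rewrite lerDl.
have coord k : (fun n => (u n : l2 R) k) @ \oo --> (x : l2 R) k.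
  have := ux (l2_delta k : H); rewrite /= l2_inner_delta.
  by under eq_fun do rewrite l2_inner_delta.
have gap j : (fun n => deriv_gap j (u n) x) @ \oo --> 0.
  apply: (lsum_dominated_cvg0 (asummable_wZ (pbound d M * (2 * M)))).
    move=> n k; rewrite normr_id; apply: le_trans (deriv_gap_lip _ M1 (uM n k) (xM k)) _.
    rewrite ler_wpM2l ?(w_ge0 j) // ler_wpM2l ?pbound_ge0 //.
    by apply: le_trans (ler_normB _ _) _; rewrite mulr2n mulrDl mul1r lerD.
  move=> k.
  have z : (fun n => w k * (pbound d M * `|(u n : l2 R) k - (x : l2 R) k|)) @ \oo --> 0.
    have -> : 0 = w k * (pbound d M * `|(x : l2 R) k - (x : l2 R) k|).
      by rewrite subrr normr0 !mulr0.
    apply: cvgM; first exact: cvg_cst.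
    apply: cvgM; first exact: cvg_cst.
    by apply: cvg_norm; apply: cvgB; [exact: coord|exact: cvg_cst].
  apply: (squeeze_cvgr _ (cvg_cst 0) z); apply: nearW => n; rewrite normr_ge0 /=.
  exact: deriv_gap_lip.
have sg : (fun n => \sum_j deriv_gap j (u n) x) @ \oo --> \sum_(j < m) (0 : R).
  by apply: cvg_big => [|j _]; [exact: add_continuous|exact: gap].
rewrite big1 // in sg.
apply: (squeeze_cvgr _ (cvg_cst 0) sg); apply: nearW => n.
exact: diag_Ddist_bound.
Qed.

Lemma diag_polynomial (k : nat) (e : 'I_k -> H) (j : 'I_m) :
  exists c : {ffun 'I_k -> 'I_d.+1} -> R, forall t : 'I_k -> R,
    F (\sum_(i < k) t i *: e i) 0 j =
    \sum_(a : {ffun 'I_k -> 'I_d.+1} | (\sum_(i < k) (a i : nat) <= d)%N)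
      c a * \prod_(i < k) t i ^+ a i.
Proof.
have mn (l : 'I_d.+1) : exists M : {ffun 'I_k -> 'I_d.+1} -> R, forall s : 'I_k -> R,
    (\sum_i s i) ^+ l =
    \sum_(a : {ffun 'I_k -> 'I_d.+1} | (\sum_(i < k) (a i : nat) == l)%N)
      M a * \prod_(i < k) s i ^+ a i.
  by apply: multinomial_expand; rewrite -ltnS.
have [Mu HMu] := choice mn.
pose deg (a : {ffun 'I_k -> 'I_d.+1}) := (\sum_(i < k) (a i : nat))%N.
(* The part of the coefficient of the monomial [a] that coordinate [n] contributes; the coefficient
   itself is the sum over [n]. *)
pose T (a : {ffun 'I_k -> 'I_d.+1}) n : R :=
  (G j n)`_(deg a) * Mu (inord (deg a)) a * \prod_(i < k) (e i : l2 R) n ^+ a i.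
have sT a : asummable (T a).
  pose B := `|Mu (inord (deg a)) a| * \prod_(i < k) `|e i| ^+ a i.
  apply: (asummable_le _ (asummable_wZ B)) => n.
  rewrite /T -mulrA normrM ler_pM // normrM ler_pM // normr_prod.
  apply: ler_prod => i _; rewrite normr_ge0 normrX lerXn2r ?nnegrE //.
  exact: l2_coord_norm.
exists (fun a => lsum (T a)) => t; rewrite mxE.
have E n : (G j n).[(\sum_(i < k) t i *: e i : l2 R) n] =
    \sum_(a : {ffun 'I_k -> 'I_d.+1} | (deg a <= d)%N) (\prod_(i < k) t i ^+ a i) * T a n.
  rewrite (horner_wide (G_size j n)) l2_sum.
  have -> : \sum_(i < k) (t i *: e i : l2 R) n = \sum_(i < k) t i * (e i : l2 R) n.
    by apply: eq_bigr => i _; rewrite l2Z.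
  rewrite [RHS](partition_big (fun a => inord (deg a) : 'I_d.+1) xpredT) //=.
  apply: eq_bigr => l _; rewrite HMu mulr_sumr.
  have ll a : (deg a == l) = ((deg a <= d)%N && (inord (deg a) == l :> 'I_d.+1)).
    case: leqP => [dl|dl] /=; last by apply/eqP => dE; move: dl; rewrite dE ltnNge -ltnS ltn_ord.
    by rewrite -val_eqE /= inordK.
  rewrite (eq_bigl (fun a => (deg a <= d)%N && (inord (deg a) == l :> 'I_d.+1)) _ ll).
  apply: eq_bigr => a /andP[da /eqP al]; rewrite /T al.
  have -> : deg a = l by rewrite -al inordK.
  have -> : \prod_(i < k) (t i * (e i : l2 R) n) ^+ a i =
      (\prod_(i < k) t i ^+ a i) * \prod_(i < k) (e i : l2 R) n ^+ a i.
    by rewrite -big_split /=; apply: eq_bigr => i _; rewrite exprMn.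
  by ring.
under eq_fun do rewrite E.
rewrite lsum_sum => [|a _]; last exact: asummableZ.
by apply: eq_bigr => a _; rewrite lsumZ // mulrC.
Qed.

Lemma diag_polyclass : polyclass d F.
Proof.
split.
- by move=> x; exact: (diag_map_diff x).1.
- move=> x e e0; have [L L0 HL] := diag_Ddist_lip x.
  exists (Num.min 1 (e / (L + 1))).
    by rewrite lt_min ltr01 divr_gt0 // ltr_wpDl.
  move=> y; rewrite lt_min => /andP[y1 ye].
  have xx : `|x - x| < 1 by rewrite subrr normr0.
  apply: le_lt_trans (HL y x y1 xx) _; move: ye; rewrite ltr_pdivlMr ?ltr_wpDl //.
  by apply: le_lt_trans; rewrite mulrDr mulr1 mulrC lerDl.
- by move=> u x; exact: diag_Ddist_weak.
- move=> x; exists 1 => //; have [L L0 HL] := diag_Ddist_lip x.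
  by exists L.
- exact: diag_polynomial.
Qed.

End DiagonalMaps.

(** * Hilbert cubes and Kolmogorov widths *)

Section HilbertCube.
Context {R : realType}.

Definition hilbert_cube (be : nat -> R) : set (l2 R) := [set x | forall k, `|x k| <= be k].

(** Along an ultrafilter every coordinate converges, since it stays in a segment. Square summability
    of the sides makes the tails uniformly small and upgrades this to convergence in norm. *)
Lemma hilbert_cube_compact be : square_summable be -> compact (hilbert_cube be).
Proof.
move=> sbe; rewrite compact_ultra => F FU FK.
have FF : ProperFilter F by exact: ultra_proper.
have coord k : exists2 y : R, `|y| <= be k & (fun x : l2 R => x k) @ F --> y.
  have [y [yk ycl]] : `[- be k, be k]%classic `&` cluster ((fun x : l2 R => x k) @ F) !=set0.
    apply: segment_compact; rewrite /fmap /=; apply: filterS FK => x /(_ k).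
    by rewrite ler_norml /= in_itv.
  exists y; first by move: yk; rewrite /= in_itv /= ler_norml.
  move=> B By; have [//|nB] := in_ultra_setVsetC ((fun x : l2 R => x k) @^-1` B) FU.
  have [z [nz Bz]] := ycl (~` B) B nB By.
  by case: nz.
have [y Hy] := choice (fun k => let: ex_intro2 y h1 h2 := coord k in ex_intro _ y (conj h1 h2)).
have sy : square_summable y.
  apply: (asummable_le _ sbe) => k.
  rewrite normrX lerXn2r ?nnegrE // ?(le_trans _ (Hy k).1) //.
exists (l2_of sy); split; first by move=> k; exact: (Hy k).1.
apply/cvgrPdist_le => e e0.
have e20 : 0 < e ^+ 2 / 2 by rewrite divr_gt0 // exprn_gt0.
(* Two points of the cube differ by at most [2 be k] in coordinate [k], whence the factor 4. *)
have [N tail] := lsum_tail (asummableZ 4 sbe) e20.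
have fin : (fun x : l2 R => \sum_(k < N) (y k - x k) ^+ 2) @ F --> \sum_(k < N) (0 : R).
  apply: cvg_big => [|k _]; first exact: add_continuous.
  have -> : 0 = (y k - y k) ^+ 2 by rewrite subrr expr0n.
  by rewrite expr2; apply: cvgM; (apply: cvgB; [exact: cvg_cst|exact: (Hy k).2]).
rewrite big1 // in fin; move/cvgr0Pnorm_lt: fin => /(_ _ e20) near_fin.
apply: (filterS _ (filterI near_fin FK)) => x [xfin xK].
have sxy := l2P (l2_of sy - x).
rewrite -(@ler_pXn2r _ 2) ?nnegrE // ?(ltW e0) // l2_normE /l2_inner.
have -> : (fun k => (l2_of sy - x) k * (l2_of sy - x) k) = fun k => (l2_of sy - x) k ^+ 2.
  by apply/funext => k; rewrite expr2.
rewrite (lsum_split N sxy) [e ^+ 2]splitr lerD //.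
  rewrite (eq_bigr (fun k : 'I_N => (y k - x k) ^+ 2)) => [|k _]; last by rewrite ltn_ord.
  by apply: le_trans (ler_norm _) (ltW xfin).
apply: le_trans (ltW tail); apply: lsum_le.
- apply: (asummable_le _ (asummable_norm sxy)) => k.
  by case: ifP => _; rewrite ?normr0.
- apply: (asummable_le _ (asummable_norm (asummableZ 4 sbe))) => k.
  by case: ifP => _; rewrite ?normr0.
move=> k; case: ifP => // _.
have h1 := (Hy k).1; have h2 := xK k.
rewrite -real_normK ?num_real // (_ : 4 * be k ^+ 2 = (be k + be k) ^+ 2); last by ring.
rewrite lerXn2r ?nnegrE // ?addr_ge0 ?(le_trans _ h1) //.
by apply: le_trans (ler_normB _ _) _; exact: lerD.
Qed.

End HilbertCube.

Section Widths.
Context {R : realType}.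
Notation H := (l2_hilbert R).

Lemma geometric_tail (s : R) n N : 0 <= s -> s < 1 ->
  \sum_(k < N) (if (k < n)%N then 0 else s ^+ k) <= s ^+ n / (1 - s).
Proof.
move=> s0 s1; have s10 : 0 < 1 - s by rewrite subr_gt0.
rewrite ler_pdivlMr //.
suff -> : (\sum_(k < N) (if (k < n)%N then 0 else s ^+ k)) * (1 - s) =
    if (N <= n)%N then 0 else s ^+ n - s ^+ N.
  by case: ifP => _; rewrite ?exprn_ge0 // lerBlDr lerDl exprn_ge0.
elim: N => [|N IH]; first by rewrite big_ord0 mul0r.
rewrite big_ord_recr /= mulrDl IH; case: (ltngtP N n) => [lt|gt|->].
- by rewrite mul0r addr0.
- by rewrite exprSr; ring.
- by rewrite exprSr; ring.
Qed.

Lemma l2_delta_indep n : lin_indep (fun i : 'I_n => l2_delta i : H).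
Proof.
move=> c c0 i; have := congr1 (fun x : l2 R => x i) c0.
rewrite l2_sum l20 (bigD1 i) //= l2Z l2_deltaE eqxx mulr1 big1 ?addr0 // => j ji.
by rewrite l2Z l2_deltaE eq_sym (negbTE (_ : (j : nat) != i)) ?mulr0.
Qed.

Lemma dist_span_ge0 n (e : 'I_n -> H) (u : H) : 0 <= dist_span e u.
Proof.
apply: lb_le_inf; first by eexists; exists (fun=> 0).
by move=> _ [c _ <-].
Qed.

Lemma kolmogorov_width_ge0 n (K : set H) : K !=set0 -> (0 <= kolmogorov_width n K)%E.
Proof.
move=> [u Ku]; apply: le_ereal_inf_tmp => _ [e _ <-].
apply: le_ereal_sup_tmp; exists (dist_span e u)%:E; first by exists u.
by rewrite lee_fin dist_span_ge0.
Qed.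

(** Approximate by truncation to the first [n] coordinates; the error is the square root of a
    geometric tail of ratio [p^2]. *)
Lemma kolmogorov_width_cube n (K : set H) (B p : R) : 0 <= B -> 0 <= p -> p < 1 ->
  K `<=` hilbert_cube (fun k => B * p ^+ k) ->
  (kolmogorov_width n K <= (B / Num.sqrt (1 - p ^+ 2) * p ^+ n)%:E)%E.
Proof.
move=> B0 p0 p1 KB; apply: ge_ereal_inf.
have q0 : 0 < 1 - p ^+ 2 by rewrite subr_gt0 exprn_ilt1.
eexists; first by exists (fun i : 'I_n => l2_delta i : H); [exact: l2_delta_indep|].
apply: ge_ereal_sup => _ [u Ku <-]; rewrite lee_fin.
set v : l2 R := (u : l2 R) - \sum_(i < n) (u : l2 R) i *: l2_delta i.
apply: (@le_trans _ _ `|v|).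
  apply: ge_inf; last by exists (fun i : 'I_n => (u : l2 R) i).
  by exists 0 => _ [c _ <-].
have vE k : v k = if (k < n)%N then 0 else (u : l2 R) k.
  rewrite l2B l2_sum; case: ltnP => kn.
    rewrite (bigD1 (Ordinal kn)) //= l2Z l2_deltaE eqxx mulr1 big1 ?addr0 ?subrr // => j jk.
    by rewrite l2Z l2_deltaE eq_sym (negbTE (_ : (j : nat) != k)) ?mulr0.
  rewrite big1 ?subr0 // => j _.
  by rewrite l2Z l2_deltaE gtn_eqF ?mulr0 // (leq_trans (ltn_ord j)).
apply: l2_norm_le => [|N]; first by rewrite mulr_ge0 ?exprn_ge0 // divr_ge0 // sqrtr_ge0.
rewrite exprMn exprMn exprVn sqr_sqrtr ?(ltW q0) // -exprM mulnC exprM.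
rewrite -mulrA [_^-1 * _]mulrC; apply: (@le_trans _ _ (B ^+ 2 * (\sum_(k < N)
   (if (k < n)%N then 0 else (p ^+ 2) ^+ k)))); last first.
  by rewrite ler_wpM2l ?sqr_ge0 // geometric_tail ?sqr_ge0 // exprn_ilt1.
rewrite mulr_sumr; apply: ler_sum => k _; rewrite vE; case: ifP => _.
  by rewrite expr0n mulr0.
rewrite -real_normK ?num_real // -exprM mulnC exprM -exprMn lerXn2r ?nnegrE //.
  by rewrite mulr_ge0 // exprn_ge0.
exact: KB.
Qed.

(** For every [e > 0] Bernoulli's inequality gives [C p^n <= (p + e)^n] eventually, which absorbs
    the constant before the root is taken. *)
Lemma limn_esup_root_le (a : nat -> \bar R) (C p : R) : 0 <= C -> 0 < p ->
  (forall n, 0 <= a n)%E -> (forall n, a n <= (C * p ^+ n)%:E)%E ->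
  (limn_esup (fun n => poweR (a n) (n%:R)^-1) <= p%:E)%E.
Proof.
move=> C0 p0 a0 aC; apply/lee_addgt0Pr => /= e e0; rewrite -EFinD.
have r1 : 1 < (p + e) / p by rewrite ltr_pdivlMr // mul1r ltrDl.
have [N HN] : exists N, forall n, (N <= n)%N -> C <= ((p + e) / p) ^+ n.
  set h := (p + e) / p - 1; have h0 : 0 < h by rewrite subr_gt0.
  have bern n : 1 + n%:R * h <= ((p + e) / p) ^+ n.
    elim: n => [|n IH]; first by rewrite mul0r addr0.
    move: IH; have -> : (p + e) / p = 1 + h by rewrite /h; ring.
    move=> IH; rewrite exprS.
    have : 0 <= n%:R * h * h by rewrite !mulr_ge0 // (ltW h0).
    have : (1 + h) * (1 + n%:R * h) <= (1 + h) * (1 + h) ^+ n.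
      by rewrite ler_wpM2l // addr_ge0 // (ltW h0).
    by rewrite -natr1; lra.
  exists (Num.truncn (C / h)).+1 => n Nn; apply: le_trans (bern n).
  have : C / h < n%:R.
    apply: lt_le_trans (truncnS_gt _) _; by rewrite ler_nat.
  by rewrite ltr_pdivrMr // => /ltW; lra.
(* Starting at [N.+1] excludes [n = 0], where the exponent [1 / n] is 0 by convention. *)
apply: ge_ereal_inf; exists (ereal_sup ((fun n => poweR (a n) (n%:R)^-1) @` [set n | (N.+1 <= n)%N])).
  by exists [set n | (N.+1 <= n)%N] => //; exists N.+1.
apply: ge_ereal_sup => _ [n Nn <-].
have n0 : n%:R != 0 :> R by rewrite pnatr_eq0 -lt0n (leq_trans _ Nn).
have pe0 : 0 < p + e by rewrite addr_gt0.
have -> : (p + e)%:E = poweR ((p + e) ^+ n)%:E (n%:R)^-1.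
  by rewrite poweR_EFin -powR_mulrn ?ltW // -powRrM mulfV // powRr1 // ltW.
apply: gt0_ler_poweR; rewrite ?invr_ge0 // ?in_itv /= ?a0 ?leey //.
  by rewrite lee_fin exprn_ge0 // ltW.
apply: le_trans (aC n) _; rewrite lee_fin.
have := HN n (ltnW Nn); rewrite expr_div_n ler_pdivlMr ?exprn_gt0 //.
Qed.

End Widths.

(** * Outer measure of boxes *)

Section BoxMeasure.
Context {R : realType}.
Local Notation mu := (@lebesgue_measure R).

Lemma forall_ordS n (P : nat -> bool) :
  [forall i : 'I_n.+1, P i] = [forall i : 'I_n, P i] && P n.
Proof.
apply/forallP/andP => [h|[/forallP h hn] i].
  split; last by have := h ord_max.
  by apply/forallP => i; have := h (widen_ord (leqnSn n) i).
have := ltn_ord i; rewrite ltnS leq_eqVlt => /orP[/eqP->//|lt].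
exact: h (Ordinal lt).
Qed.

(* Weighted covers make the induction on the dimension go through: slicing at
   the last coordinate only changes the weights. *)
Lemma weighted_box_cover n (l u : nat -> R) (a b : nat -> nat -> R) (w : nat -> R) (c : R) :
  (forall i, l i <= u i) -> (forall k i, a k i <= b k i) -> (forall k, 0 <= w k) -> 0 <= c ->
  (forall x : nat -> R, (forall i, (i < n)%N -> l i <= x i <= u i) ->
    (c%:E <= \sum_(0 <= k <oo)
      (if [forall i : 'I_n, a k i <= x i <= b k i] then w k else 0)%:E)%E) ->
  ((c * \prod_(i < n) (u i - l i))%:E <=
    \sum_(0 <= k <oo) (w k * \prod_(i < n) (b k i - a k i))%:E)%E.
Proof.
move=> lu ab; elim: n w c => [|n IH] w c w0 c0 cover.
  rewrite big_ord0 mulr1; have := cover (fun=> 0) (fun _ => ltac:(by [])).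
  move=> /le_trans; apply; apply: lee_nneseries => [k _ _|k _].
    by rewrite lee_fin; case: ifP.
  by rewrite big_ord0 mulr1 lee_fin; case: ifP.
pose v k : R := \prod_(i < n) (b k i - a k i).
have v0 k : 0 <= v k by apply: prodr_ge0 => i _; rewrite subr_ge0.
pose P := \prod_(i < n) (u i - l i).
have P0 : 0 <= P by apply: prodr_ge0 => i _; rewrite subr_ge0.
pose wt (t : R) k : R := if a k n <= t <= b k n then w k else 0.
have slice (t : R) : l n <= t <= u n ->
    ((c * P)%:E <= \sum_(0 <= k <oo) (wt t k * v k)%:E)%E.
  move=> tn; apply: IH => // [k|x xb]; first by rewrite /wt; case: ifP.
  have := cover (fun i => if (i < n)%N then x i else t).
  move=> /(_ _)/le_trans; apply.
    move=> i; rewrite ltnS leq_eqVlt => /orP[/eqP->|lt]; first by rewrite ltnn.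
    by rewrite lt; exact: xb.
  apply: lee_nneseries => [k _ _|k _]; first by rewrite lee_fin; case: ifP.
  rewrite (@forall_ordS n (fun i => a k i <= (if (i < n)%N then x i else t) <= b k i)) ltnn.
  rewrite lee_fin /wt (eq_forallb (P2 := fun i : 'I_n => a k i <= x i <= b k i)).
    by case: [forall i : 'I_n, a k i <= x i <= b k i].
  by move=> i; rewrite ltn_ord.
pose D := `[l n, u n]%classic : set R.
have mD : measurable D by exact: measurable_itv.
have lenD (x y : R) : x <= y -> mu `[x, y]%classic = (y - x)%:E.
  move=> xy; rewrite lebesgue_measure_itv /= lte_fin; case: ltP => // yx.
  by rewrite (@le_anti _ _ x y) ?xy ?yx // subrr.
pose g k (t : R) : \bar R := ((w k * v k)%:E * (\1_(`[a k n, b k n]%classic : set R) t)%:E)%E.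
have gE k t : ((wt t k * v k)%:E = g k t)%E.
  rewrite /g -EFinM /wt indicE mem_setE in_itv /=.
  by case: ifP; rewrite ?mulr1 ?mul0r ?mulr0.
have g0 k t : (0 <= g k t)%E by rewrite -gE lee_fin mulr_ge0 // /wt; case: ifP.
have mg k : measurable_fun D (fun t : R => g k t).
  apply: measurable_funeM; apply/measurable_EFinP.
  by apply: measurable_indic; exact: measurable_itv.
have -> : (c * \prod_(i < n.+1) (u i - l i))%:E = (\int[mu]_(t in D) (c * P)%:E)%E.
  transitivity ((c * P)%:E * mu D)%E; last by rewrite integral_cst.
  by rewrite /D lenD // big_ord_recr /= mulrA EFinM.
(* Integrate the slice inequality over the last coordinate and exchange sum and integral. Each box
   then contributes the length of its last side inside [D], at most [b k n - a k n]. *)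
apply: (@le_trans _ _ (\int[mu]_(t in D) (\sum_(0 <= k <oo) g k t))%E).
  apply: ge0_le_integral => //=.
  - by move=> t _; rewrite lee_fin mulr_ge0.
  - by apply: ge0_emeasurable_sum => [k t _ _|k _]; [exact: g0|exact: mg].
  - move=> t; rewrite /D /= in_itv /= => /slice /le_trans; apply.
    by apply: lee_nneseries => [k _ _|k _]; rewrite gE.
rewrite integral_nneseries //; apply: lee_nneseries => [k _ _|k _].
  by apply: integral_ge0 => t _; exact: g0.
rewrite ge0_integralZl_EFin //; last 2 first.
- by apply/measurable_EFinP; apply: measurable_indic; exact: measurable_itv.
- exact: mulr_ge0.
rewrite integral_indic //.
rewrite big_ord_recr /= -/(v k) mulrA (EFinM (w k * v k)).
apply: lee_wpmul2l; first by rewrite lee_fin mulr_ge0.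
rewrite -lenD //; apply: le_measure; rewrite ?inE //; try exact: measurable_itv.
exact: measurableI.
Qed.

(** The cover inequality with all weights 1: the volumes of any countable box cover of [A] add up to
    at least the volume of the inner box. *)
Lemma lebesgue_outer_box m (l u : 'rV[R]_m.+1) (A : set 'rV[R]_m.+1) :
  (forall i, l 0 i < u 0 i) -> box l u `<=` A -> (0%:E < lebesgue_outer A)%E.
Proof.
move=> lu boxA.
have lu' (i : nat) : l 0 (inord i) <= u 0 (inord i) by exact: ltW.
apply: (@lt_le_trans _ _ (\prod_(i < m.+1) (u 0 i - l 0 i))%:E).
  by rewrite lte_fin; apply: prodr_gt0 => i _; rewrite subr_gt0.
apply: le_ereal_inf_tmp => _ [[a b] /= [ab Acov] <-].
have := @weighted_box_cover m.+1 (fun i => l 0 (inord i)) (fun i => u 0 (inord i))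
  (fun k i => a k 0 (inord i)) (fun k i => b k 0 (inord i)) (fun=> 1) 1 lu'
  (fun k i => ab k (inord i)) (fun=> ler01) ler01.
rewrite mul1r (eq_bigr (fun i => u 0 i - l 0 i)) => [|i _]; last by rewrite inord_val.
rewrite (@eq_eseriesr _ _ (fun k => (\prod_(i < m.+1) (b k 0 i - a k 0 i))%:E)) => [|k _]; last first.
  by rewrite mul1r; congr EFin; apply: eq_bigr => i _; rewrite inord_val.
apply => x xb.
pose y : 'rV[R]_m.+1 := \row_i x i.
have [k _ yk] : (\bigcup_k box (a k) (b k)) y.
  apply: Acov; apply: boxA => i; rewrite mxE.
  by have := xb i (ltn_ord i); rewrite inord_val.
apply: (@le_trans _ _ ((if [forall i : 'I_m.+1,
    a k 0 (inord i) <= x i <= b k 0 (inord i)] then 1 else 0) : R)%:E).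
  rewrite ifT //; apply/forallP => i; rewrite inord_val.
  by have := yk i; rewrite mxE.
pose f k : \bar R := ((if [forall i : 'I_m.+1,
  a k 0 (inord i) <= x i <= b k 0 (inord i)] then 1 else 0) : R)%:E.
have f0 i : (0 <= f i)%E by rewrite lee_fin; case: ifP.
apply: le_trans (@nneseries_lim_ge _ f xpredT 0 k.+1 (fun i _ _ => f0 i)).
by rewrite big_nat_recr //= leeDr // sume_ge0.
Qed.

End BoxMeasure.

(** * The counterexample *)

Section Digits.
Context {R : realType}.
Variables (e m : nat) (s : R).
Let th : R := e.+1%:R^-1.
Let th0 : 0 < th. Proof. by rewrite invr_gt0. Qed.

(** On [[0, e + 1]] the cap at [e] matters only at the right endpoint, where truncation would give
    the illegal digit [e + 1]. *)
Definition digit (t : R) : nat := minn (Num.trunc t) e.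

Lemma digit_bounds (t : R) : 0 <= t <= e.+1%:R -> 0 <= t - (digit t)%:R <= 1.
Proof.
move=> /andP[t0 te]; rewrite /digit.
have /andP[lo hi] := truncn_itv t0; rewrite /minn; case: ltnP => te'.
  by rewrite subr_ge0 lo /= lerBlDl natr1 ltW.
have [E|lt] := eqVneq t e.+1%:R; first by rewrite E -natr1; lra.
have tl : t < e.+1%:R by rewrite lt_neqAle lt.
have Ee : Num.trunc t = e.
  by apply/eqP; rewrite eqn_leq te' andbT truncn_le_nat.
by move: lo hi; rewrite Ee -natr1; lra.
Qed.

(* The greedy base [e.+1] expansion of [s] whose first digit has index [m]. *)
Fixpoint expansion (k : nat) : R :=
  if k is k'.+1 then
    expansion k' +
    (if (k' < m)%N then 0 else th ^+ k' * (digit ((s - expansion k') / th ^+ k'))%:R)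
  else 0.

Definition expansion_digit k : nat :=
  if (k < m)%N then 0%N else digit ((s - expansion k) / th ^+ k).

Hypothesis s_bounds : 0 <= s <= e.+1%:R * th ^+ m.

Lemma expansion_sum n :
  expansion n = \sum_(k < n) (if (k < m)%N then 0 else th ^+ k * (expansion_digit k)%:R).
Proof.
elim: n => [|n IH]; first by rewrite big_ord0.
by rewrite big_ord_recr /= -IH /expansion_digit; case: ltnP.
Qed.

(** The bound is the value of an expansion from index [n] on with all digits equal to [e]. It is the
    invariant that makes the next digit legal, and at [n = m] it is the hypothesis on [s]. *)
Lemma expansion_error n : (m <= n)%N -> 0 <= s - expansion n <= e.+1%:R * th ^+ n.
Proof.
have small k : (k <= m)%N -> expansion k = 0.
  elim: k => // k IH km; rewrite /= IH ?km ?addr0 //; exact: ltnW.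
elim: n => [|n IH]; first by rewrite leqn0 => /eqP m0; rewrite small ?m0 // -m0 subr0.
rewrite leq_eqVlt => /orP[/eqP mE|mn]; first by rewrite small ?mE // subr0 -mE.
rewrite ltnS in mn; have tn : 0 < th ^+ n by rewrite exprn_gt0.
have /andP[lo hi] := IH mn; rewrite /= ltnNge mn /=.
set r := s - expansion n; set t := r / th ^+ n.
have rE : r = t * th ^+ n by rewrite divfK // gt_eqF.
have /digit_bounds : 0 <= t <= e.+1%:R.
  by rewrite /t divr_ge0 ?(ltW tn) //= ler_pdivrMr.
have -> : s - (expansion n + th ^+ n * (digit t)%:R) = th ^+ n * (t - (digit t)%:R).
  by rewrite opprD addrA -/r rE; ring.
move=> /andP[l1 l2]; rewrite mulr_ge0 ?(ltW tn) //=.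
rewrite exprS mulrA mulfV ?pnatr_eq0 // mul1r.
by rewrite ler_piMr // ltW.
Qed.

Lemma expansion_lsum : (0 < e)%N ->
  lsum (fun k => if (k < m)%N then 0 else th ^+ k * (expansion_digit k)%:R) = s.
Proof.
move=> e0; apply/cvg_lim => //; apply/cvgrPdist_le => eps eps0.
have th1 : `|th| < 1 by rewrite gtr0_norm // invf_lt1 // ltr1n ltnS.
have /cvgr0Pnorm_le/(_ (eps / e.+1%:R)) := cvg_expr th1.
rewrite divr_gt0 // => /(_ isT) [N _ HN].
exists (maxn N m) => // n /=; rewrite geq_max => /andP[Nn mn].
have := HN n Nn; rewrite /= ger0_norm ?exprn_ge0 ?(ltW th0) //.
rewrite ler_pdivlMr // => tl.
rewrite /series /= big_mkord -expansion_sum.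
have /andP[lo hi] := expansion_error mn.
by rewrite ger0_norm // (le_trans hi) // mulrC.
Qed.

Lemma expansion_digit_le k : (expansion_digit k <= e)%N.
Proof. by rewrite /expansion_digit; case: ifP => // _; exact: geq_minr. Qed.

End Digits.

Section GeometricSeries.
Context {R : realType}.

Lemma asummable_geometric (s : R) : 0 <= s -> s < 1 -> asummable (fun k => s ^+ k).
Proof.
move=> s0 s1; apply: (@asummable_bounded _ _ (s ^+ 0 / (1 - s))) => [k|n].
  exact: exprn_ge0.
by have := geometric_tail 0 n s0 s1.
Qed.

Lemma square_summable_geometric (B p : R) : 0 <= p -> p < 1 ->
  square_summable (fun k => B * p ^+ k).
Proof.
move=> p0 p1; rewrite /square_summable.
have -> : (fun k => (B * p ^+ k) ^+ 2) = fun k => B ^+ 2 * (p ^+ 2) ^+ k.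
  by apply/funext => k; rewrite exprMn -!exprM mulnC.
by apply/asummableZ/asummable_geometric; [exact: sqr_ge0|exact: exprn_ilt1].
Qed.

Lemma lsum_delta (c : nat -> R) n : lsum (fun k => c k * (if k == n then 1 else 0)) = c n.
Proof.
rewrite (@lsum_fin _ _ n.+1) => [|k nk]; last by rewrite gtn_eqF // mulr0.
by rewrite big_ord_recr /= eqxx mulr1 big1 ?add0r // => k _; rewrite ltn_eqF // mulr0.
Qed.

End GeometricSeries.

(** * The map, its critical set and its critical values, with [d = e.+2], [D = e.+1] and target
    dimension [m.+1] *)

Section Counterexample.
Context {R : realType}.
Variables (e m : nat) (q : R) (p : {poly R}) (a kap : R).
Hypotheses (e0 : (0 < e)%N) (q1 : 1 < q) (qlt : q ^+ e.+2 < e.+1%:R).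
Hypotheses (p_size : (size p <= e.+3)%N) (kap0 : 0 < kap) (p_deriv : p^`() != 0)
  (p_root0 : root p^`() 0)
  (p_values : forall j, (j <= e)%N -> exists2 x, root p^`() x & p.[x] = a + kap * j%:R).

Local Notation th := (e.+1%:R^-1 : R).
Notation H := (l2_hilbert R).

(* The [m] first coordinates of the map are the [m] first coordinates of the
   point; the last one is [sum_(k >= m) e.+1^-k p (q^k x_k)]. *)
Definition ex_coef (j : 'I_m.+1) (k : nat) : {poly R} :=
  if (j < m)%N then (if k == j then 'X else 0)
  else if (k < m)%N then 0 else th ^+ k *: (p \Po (q ^+ k *: 'X)).

(** The 1 is for the coordinate functions. Coefficient [l] of [D^-k p(q^k X)] is [p_l q^(kl) D^-k],
    and [l <= e.+2] with [q > 1] gives the ratio [q^d / D < 1]. *)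
Definition ex_weight (k : nat) : R :=
  (if (k < m)%N then 1 else 0) + (\sum_(l < e.+3) `|p`_l|) * (q ^+ e.+2 * th) ^+ k.

Let q0 : 0 < q. Proof. exact: lt_trans q1. Qed.
Let qV0 : 0 <= q^-1. Proof. by rewrite invr_ge0 ltW. Qed.
Let qV1 : q^-1 < 1. Proof. by rewrite invf_lt1. Qed.
Let th_gt0 : 0 < th. Proof. by rewrite invr_gt0. Qed.
Let rho0 : 0 <= q ^+ e.+2 * th. Proof. by rewrite mulr_ge0 ?exprn_ge0 ?ltW. Qed.
Let rho1 : q ^+ e.+2 * th < 1. Proof. by rewrite ltr_pdivrMr // mul1r. Qed.

Lemma ex_weight_sum : asummable ex_weight.
Proof.
apply: asummableD; last exact/asummableZ/asummable_geometric.
by apply: (@asummable_fin _ _ m) => k mk; rewrite ltnNge mk.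
Qed.

Lemma comp_scaleX (c : R) : p \Po (c *: 'X) = \poly_(l < size p) (p`_l * c ^+ l).
Proof.
rewrite comp_polyE poly_def; apply: eq_bigr => l _.
by rewrite exprZn scalerA.
Qed.

Lemma ex_size j k : (size (ex_coef j k) <= e.+3)%N.
Proof.
rewrite /ex_coef; case: ifP => _; case: ifP => _; rewrite ?size_poly0 ?size_polyX //.
apply: leq_trans (size_scale_leq _ _) _.
by rewrite comp_scaleX (leq_trans (size_poly _ _)).
Qed.

Lemma ex_coef_le j k l : `|(ex_coef j k)`_l| <= ex_weight k.
Proof.
have S0 : 0 <= (\sum_(l < e.+3) `|p`_l|) * (q ^+ e.+2 * th) ^+ k.
  by rewrite mulr_ge0 ?sumr_ge0 // exprn_ge0.
rewrite /ex_coef /ex_weight; case: (ltnP j m) => jm.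
  case: eqP => [kj|_]; last by rewrite coef0 normr0 addr_ge0 //; case: ifP.
  have -> : (k < m)%N by rewrite kj.
  apply: (@le_trans _ _ 1); last by rewrite lerDl.
  by rewrite coefX; case: (l == 1%N); rewrite ?normr1 ?normr0.
case: ifP => _; first by rewrite coef0 normr0 addr_ge0.
rewrite add0r coefZ comp_scaleX coef_poly; case: ltnP => ls; last by rewrite mulr0 normr0.
have le : (l < e.+3)%N by exact: leq_trans p_size.
rewrite !normrM ger0_norm ?exprn_ge0 ?(ltW th_gt0) // [`|_ ^+ l|]ger0_norm ?exprn_ge0 ?exprn_ge0 ?(ltW q0) //.
rewrite mulrCA exprMn -exprM; apply: ler_pM => //.
- by rewrite mulr_ge0 // !exprn_ge0 // ltW.
- by rewrite (bigD1 (Ordinal le)) //= lerDl sumr_ge0.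
rewrite mulrC ler_wpM2r ?exprn_ge0 ?(ltW th_gt0) // -exprM mulnC.
by rewrite ler_weXn2l ?(ltW q1) // leq_mul2r -ltnS le orbT.
Qed.

Definition ex_map : H -> 'rV[R]_m.+1 := diag_map ex_coef.

Lemma ex_polyclass : polyclass e.+2 ex_map.
Proof. exact: (diag_polyclass ex_weight_sum ex_size ex_coef_le). Qed.

Lemma ex_diffE (x : H) : 'd ex_map x = diag_diff ex_coef x :> (l2 R -> 'rV[R]_m.+1).
Proof. exact: (diag_map_diff ex_weight_sum ex_size ex_coef_le x).2. Qed.

Lemma ex_coef_deriv_lo (j : 'I_m.+1) k t : (j < m)%N ->
  (ex_coef j k)^`().[t] = if k == j then 1 else 0.
Proof. by rewrite /ex_coef => ->; case: eqP => _; rewrite ?derivX ?deriv0 !hornerE. Qed.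

Lemma ex_coef_deriv_hi k t : (ex_coef ord_max k)^`().[t] =
  if (k < m)%N then 0 else th ^+ k * (q ^+ k * p^`().[q ^+ k * t]).
Proof.
rewrite /ex_coef /= ltnn; case: ifP => _; first by rewrite deriv0 horner0.
rewrite derivZ deriv_comp derivZ derivX hornerZ hornerM horner_comp !hornerZ hornerX hornerC.
by rewrite mulr1 [_ * q ^+ k]mulrC.
Qed.

(** If the derivative is nonzero at some [k >= m], the first [m] basis vectors and the [k]-th one
    have images forming an invertible diagonal matrix. If it vanishes for all [k >= m], the last
    component of the differential is 0 and the rank is at most [m]. *)
Lemma ex_CritP (x : H) : Crit ex_map x <->
  (forall k, (m <= k)%N -> p^`().[q ^+ k * (x : l2 R) k] = 0).
Proof.
split=> [xC k mk|x0 n v].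
  apply/eqP/negPn/negP => nz.
  pose v (i : 'I_m.+1) : H := if (i < m)%N then l2_delta i else l2_delta k.
  pose c : R := th ^+ k * (q ^+ k * p^`().[q ^+ k * (x : l2 R) k]).
  have c0 : c != 0 by rewrite !mulf_neq0 // expf_neq0 // ?gt_eqF.
  have := xC _ v; rewrite /= leqNgt => /negP; apply.
  have -> : \matrix_(i < m.+1) ('d ex_map x (v i) : 'rV[R]_m.+1) =
      diag_mx (\row_(j < m.+1) (if (j < m)%N then 1 else c)).
    apply/matrixP => i j; rewrite ex_diffE !mxE /v.
    have [jm|mj] := ltnP j m.
      under eq_fun do rewrite ex_coef_deriv_lo // mulrC.
      rewrite lsum_delta; case: ltnP => im; rewrite l2_deltaE.
        by rewrite eq_sym -val_eqE; case: eqP.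
      rewrite ltn_eqF ?(leq_trans jm) //; case: eqP => // ij.
      by move: im; rewrite ij leqNgt jm.
    have -> : j = ord_max by apply/val_inj/eqP; rewrite eqn_leq -ltnS ltn_ord.
    under eq_fun do rewrite ex_coef_deriv_hi.
    case: (ltnP i m) => im.
      under eq_fun do rewrite l2_deltaE.
      rewrite lsum_delta im; case: eqP => // E; by rewrite E /= ltnn in im.
    under eq_fun do rewrite l2_deltaE.
    rewrite lsum_delta ltnNge mk /=.
    have -> : i = ord_max by apply/val_inj/eqP; rewrite eqn_leq -ltnS ltn_ord.
    by rewrite eqxx.
  rewrite mxrank_unit // unitmxE det_diag unitfE; apply/prodf_neq0 => j _.
  by rewrite mxE; case: ifP => // _; rewrite oner_eq0.
set A := \matrix_i _.
have z : A *m (delta_mx ord_max 0 : 'cV[R]_m.+1) = 0; last first.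
  by have := mulmx0_rank_max z; rewrite mxrank_delta addn1.
apply/matrixP => i j; rewrite !mxE big1 // => l _; rewrite !mxE ex_diffE andbC ord1 eqxx /=.
case: eqP => [->|_]; last by rewrite mulr0.
rewrite mxE; under eq_fun do rewrite ex_coef_deriv_hi.
rewrite (_ : (fun _ => _) = fun=> 0) ?lsum0 ?mul0r //; apply/funext => k.
by case: ltnP => [_|mk]; rewrite ?mul0r // x0 // !mulr0 mul0r.
Qed.

Definition ex_K (r : R) : set H := Crit ex_map `&` @closed_ballH R H r.

Let B : R := cauchy_bound p^`().
Let rootB t : p^`().[t] = 0 -> `|t| <= B.
Proof. by move=> t0; rewrite ltW // cauchy_boundP. Qed.
Let B_ge0 : 0 <= B.
Proof. by have /rootP/rootB := p_root0; apply: le_trans. Qed.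

(** A common bound for [q^k x_k] on the critical set: [B] bounds the roots of the derivative
    ([k >= m]), and [r q^m] takes care of the free coordinates ([k < m]). *)
Definition ex_radius (r : R) : R := B + r * q ^+ m.

Lemma ex_cube r (x : l2 R) : 0 <= r ->
  (forall k, (k < m)%N -> `|x k| <= r) ->
  (forall k, (m <= k)%N -> p^`().[q ^+ k * x k] = 0) ->
  hilbert_cube (fun k => ex_radius r * q^-1 ^+ k) x.
Proof.
move=> r0 xlo xhi k; have qk : 0 < q ^+ k by rewrite exprn_gt0.
rewrite exprVn ler_pdivlMr //; have [km|mk] := ltnP k m.
  apply: (@le_trans _ _ (r * q ^+ m)); last by rewrite lerDr.
  by apply: ler_pM => //; [rewrite ltW|exact: xlo|rewrite ler_weXn2l ?(ltW q1) // ltnW].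
have := rootB (xhi k mk); rewrite normrM gtr0_norm // mulrC => /le_trans; apply.
by rewrite lerDl mulr_ge0 // exprn_ge0 // ltW.
Qed.

Lemma ex_radius_ge0 r : 0 <= r -> 0 <= ex_radius r.
Proof. by move=> r0; rewrite addr_ge0 // mulr_ge0 // exprn_ge0 // ltW. Qed.

Lemma ex_K_cube r : 0 <= r -> ex_K r `<=` hilbert_cube (fun k => ex_radius r * q^-1 ^+ k).
Proof.
move=> r0 x [/ex_CritP xC xr]; apply: ex_cube => // k _.
exact: le_trans (l2_coord_norm x k) xr.
Qed.

Lemma l2_coord_continuous k : continuous (fun x : l2 R => x k).
Proof.
move=> x; apply/(@cvgrPdist_le _ _ _ (nbhs x)) => eps eps0; near=> y.
rewrite -l2B; apply: le_trans (l2_coord_norm _ k) _.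
by near: y; apply: cvgr_dist_le.
Unshelve. all: by end_near. Qed.

Lemma ex_K_compact r : 0 <= r -> compact (ex_K r).
Proof.
move=> r0; apply: (subclosed_compact _ _ (ex_K_cube r0)); last first.
  exact/hilbert_cube_compact/square_summable_geometric.
have -> : ex_K r = [set x : l2 R | `|x| <= r] `&`
    \bigcap_(k in [set k | (m <= k)%N]) [set x : l2 R | p^`().[q ^+ k * x k] = 0].
  apply/seteqP; split => x.
    by move=> [/ex_CritP xC xr]; split => // k mk; exact: xC.
  by move=> [xr xC]; split => //; apply/ex_CritP => k mk; exact: xC.
apply: closedI.
  apply: (@closed_comp _ _ (fun x : l2 R => `|x|) [set t | t <= r]); last exact: closed_le.
  by move=> x _; exact: norm_continuous.
apply: closed_bigI => k _.
apply: (@closed_comp _ _ (fun x : l2 R => p^`().[q ^+ k * x k]) [set t | t = 0]); last first.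
  exact: closed_eq.
move=> x _; apply: (@continuous_comp _ _ _ (fun x : l2 R => q ^+ k * x k) (horner p^`())).
  apply: (@continuous_comp _ _ _ (fun x : l2 R => x k) ( *%R (q ^+ k))).
    exact: l2_coord_continuous.
  exact: mulrl_continuous.
exact: continuous_horner.
Qed.

Lemma ex_K_width r : 0 < r ->
  (limn_esup (fun n => poweR (kolmogorov_width n (ex_K r)) (n%:R)^-1) <= (q^-1)%:E)%E.
Proof.
move=> r0.
(* The origin is critical because 0 is a root of the derivative. Nonemptiness keeps the widths
   nonnegative: the supremum over an empty set would be minus infinity. *)
have K0 : ex_K r !=set0.
  exists (0 : l2 R); split; last by rewrite /closed_ballH /= normr0 ltW.
  by apply/ex_CritP => k _; rewrite l20 mulr0; exact/rootP.
apply: (@limn_esup_root_le _ _ (ex_radius r / Num.sqrt (1 - q^-1 ^+ 2))).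
- by rewrite divr_ge0 ?sqrtr_ge0 // ex_radius_ge0 // ltW.
- by rewrite invr_gt0.
- by move=> n; exact: kolmogorov_width_ge0.
- move=> n; apply: kolmogorov_width_cube => //; first by rewrite ex_radius_ge0 // ltW.
  exact/ex_K_cube/ltW.
Qed.

(** A box lies in the image. For a target [y], the free coordinates are copied from [y], and the
    digits of the rescaled last coordinate select which root of the derivative each [q^k x_k]
    equals. *)
Lemma ex_image_pos : exists2 r : R, 0 < r &
  (0%:E < lebesgue_outer (ex_map @` (Crit ex_map `&` ex_K r)))%E.
Proof.
pose be k := ex_radius 1 * q^-1 ^+ k.
have sbe : square_summable be by exact: square_summable_geometric.
(* All preimages lie in the cube with sides [be], so its l2 radius serves the whole box; the 1 makes
   [r] positive. *)
pose r : R := Num.sqrt (lsum (fun k => be k ^+ 2)) + 1.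
pose S : R := lsum (fun k => if (k < m)%N then 0 else th ^+ k).
pose len : R := kap * (e.+1%:R * th ^+ m).
have len0 : 0 < len by rewrite !mulr_gt0 // exprn_gt0.
have th1 : th < 1 by rewrite invf_lt1 // ltr1n ltnS.
have sgeo : asummable (fun k => if (k < m)%N then 0 else th ^+ k).
  apply: (asummable_le _ (asummable_geometric (ltW th_gt0) th1)) => k.
  by case: ifP => _; rewrite ?normr0 ?ger0_norm ?exprn_ge0 // ltW.
exists r; first by rewrite ltr_wpDl // sqrtr_ge0.
pose lo : 'rV[R]_m.+1 := \row_j (if (j < m)%N then -1 else a * S).
pose hi : 'rV[R]_m.+1 := \row_j (if (j < m)%N then 1 else a * S + len).
apply: (@lebesgue_outer_box _ _ lo hi).
  by move=> i; rewrite !mxE; case: ifP => _; rewrite ?ltrDl // ltrN10 ltr01.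
move=> y yb.
(* With digits [J k] the last component is the sum of [D^-k (a + kap J_k)], that is [a S + kap s];
   [len] is [kap] times the largest possible expansion. *)
pose s := (y 0 ord_max - a * S) / kap.
have s_bounds : 0 <= s <= e.+1%:R * th ^+ m.
  have := yb ord_max; rewrite !mxE ltnn => /andP[y1 y2].
  by rewrite divr_ge0 ?subr_ge0 ?(ltW kap0) //= ler_pdivrMr // lerBlDl [_ * kap]mulrC.
have crit j : exists x, (j <= e)%N -> p^`().[x] = 0 /\ p.[x] = a + kap * j%:R.
  have [je|ej] := leqP j e; last by exists 0.
  by have [x /rootP xr xv] := p_values je; exists x.
have [cr crP] := choice crit.
pose J := expansion_digit e m s.
have Je k : (J k <= e)%N by exact: expansion_digit_le.
pose xf k : R := if (k < m)%N then y 0 (inord k) else cr (J k) / q ^+ k.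
have qk k : q ^+ k != 0 by rewrite expf_neq0 // gt_eqF.
have xf_hi k : (m <= k)%N -> q ^+ k * xf k = cr (J k).
  by move=> mk; rewrite /xf ltnNge mk /= mulrC divfK.
have xf_lo k : (k < m)%N -> `|xf k| <= 1.
  move=> km; rewrite /xf km; have := yb (inord k).
  by rewrite !mxE inordK ?km ?ltnS ?(ltnW km) // ler_norml.
have xf_be k : `|xf k| <= be k.
  have qk0 : 0 < q ^+ k by rewrite exprn_gt0.
  rewrite /be exprVn ler_pdivlMr //; have [km|mk] := ltnP k m.
    apply: (@le_trans _ _ (1 * q ^+ m)); last by rewrite lerDr.
    by apply: ler_pM => //; [rewrite ltW|exact: xf_lo|rewrite ler_weXn2l ?(ltW q1) // ltnW].
  have := rootB (crP (J k) (Je k)).1; rewrite -xf_hi // normrM gtr0_norm // mulrC.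
  by move=> /le_trans; apply; rewrite lerDl mul1r exprn_ge0 // ltW.
have be0 k : 0 <= be k by exact: le_trans (xf_be k).
have xf2 k : xf k ^+ 2 <= be k ^+ 2.
  by rewrite -real_normK ?num_real // lerXn2r ?nnegrE.
have sx : square_summable xf.
  by apply: (asummable_le _ sbe) => k; rewrite ger0_norm ?sqr_ge0.
pose x : l2 R := l2_of sx.
have xC : Crit ex_map x.
  by apply/ex_CritP => k mk; rewrite -[x k]/(xf k) xf_hi // (crP _ (Je k)).1.
exists x; first split => //.
  split => //; rewrite /closed_ballH /=.
  apply: (@le_trans _ _ (Num.sqrt (lsum (fun k => be k ^+ 2)))); last by rewrite lerDl.
  apply: l2_norm_le; first exact: sqrtr_ge0.
  move=> n; rewrite sqr_sqrtr; last by apply: lsum_ge0 => // k; exact: sqr_ge0.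
  apply: le_trans (lsum_ge_partial n sbe (fun k => sqr_ge0 _)).
  by apply: ler_sum => k _; exact: xf2.
apply/rowP => j; rewrite mxE; have [jm|mj] := ltnP j m.
  rewrite (_ : (fun k => _) = fun k => x k * (if k == j then 1 else 0)).
    by rewrite lsum_delta -[x j]/(xf j) /xf jm inord_val.
  by apply/funext => k; rewrite /ex_coef jm; case: eqP => _; rewrite !hornerE ?mulr1 ?mulr0.
have -> : j = ord_max by apply/val_inj/eqP; rewrite eqn_leq -ltnS ltn_ord.
rewrite (_ : (fun k => _) = fun k => a * (if (k < m)%N then 0 else th ^+ k) +
    kap * (if (k < m)%N then 0 else th ^+ k * (J k)%:R)).
  have sJ : asummable (fun k => if (k < m)%N then 0 else th ^+ k * (J k)%:R).
    apply: (asummable_le _ (asummableZ e%:R sgeo)) => k.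
    case: ifP => _; first by rewrite normr0 mulr0.
    rewrite ger0_norm ?mulr_ge0 ?exprn_ge0 ?(ltW th_gt0) // mulrC.
    by rewrite ler_wpM2r ?exprn_ge0 ?(ltW th_gt0) // ler_nat.
  rewrite lsumD; [|exact: asummableZ..].
  rewrite !lsumZ // -/S expansion_lsum // /s [kap * _]mulrC divfK ?gt_eqF //.
  by rewrite addrC subrK.
apply/funext => k; rewrite /ex_coef /= ltnn; case: ltnP => mk.
  by rewrite horner0 !mulr0 addr0.
rewrite hornerZ horner_comp hornerZ hornerX -[x k]/(xf k) xf_hi // (crP _ (Je k)).2; ring.
Qed.

End Counterexample.

Theorem theoremB (R : realType) (d m : nat) :
  (3 <= d)%N -> (1 <= m)%N ->
  (forall q : R, 1 < q -> q < powR (d.-1)%:R (d%:R)^-1 ->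
    exists H : hilbertSpace R, exists f : H -> 'rV[R]_m,
      polyclass d f /\
      (forall r : R, 0 < r ->
         compact (Crit f `&` (@closed_ballH R H r)) /\
         (limn_esup (fun n => poweR (kolmogorov_width n (Crit f `&` (@closed_ballH R H r)))
                                    (n%:R)^-1)
            <= (q^-1)%:E)%E) /\
      (exists2 r : R, 0 < r &
         (0%:E < lebesgue_outer (f @` (Crit f `&` (Crit f `&` (@closed_ballH R H r)))))%E))
  /\
  (forall beta0 : R, 1 < beta0 ->
     (forall (H : hilbertSpace R) (K : set H) (q : R) (f : H -> 'rV[R]_m),
        compact K -> beta0 < q ->
        (limn_esup (fun n => poweR (kolmogorov_width n K) (n%:R)^-1) <= (q^-1)%:E)%E ->
        polyclass d f ->
        lebesgue_outer (f @` (Crit f `&` K)) = 0%:E) ->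
     powR (d.-1)%:R (d%:R)^-1 <= beta0).
Proof.
move=> d3 m1.
have part1 : forall q : R, 1 < q -> q < powR (d.-1)%:R (d%:R)^-1 ->
    exists H : hilbertSpace R, exists f : H -> 'rV[R]_m,
      polyclass d f /\
      (forall r : R, 0 < r ->
         compact (Crit f `&` (@closed_ballH R H r)) /\
         (limn_esup (fun n => poweR (kolmogorov_width n (Crit f `&` (@closed_ballH R H r)))
                                    (n%:R)^-1)
            <= (q^-1)%:E)%E) /\
      (exists2 r : R, 0 < r &
         (0%:E < lebesgue_outer (f @` (Crit f `&` (Crit f `&` (@closed_ballH R H r)))))%E).
  move=> q q1 qd; case: m m1 => // m' _.
  case: d d3 qd => [|[|e]] // e0 qd.
  have qlt : q ^+ e.+2 < e.+1%:R.
    have q0 : 0 <= q by rewrite (le_trans ler01) // ltW.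
    have := @gt0_ltr_powR R e.+2%:R (ltr0Sn _ _) q (powR e.+1%:R e.+2%:R^-1).
    rewrite !nnegrE q0 powR_ge0 => /(_ isT isT qd).
    by rewrite powR_mulrn // -powRrM mulVf ?pnatr_eq0 // powRr1.
  have [p [a [k [sp k0 dp rp vp]]]] := @equispaced_critical_values R e e0.
  exists (l2_hilbert R), (@ex_map R e m' q p); split.
    exact: ex_polyclass.
  split; last exact: ex_image_pos vp.
  move=> r r0; split; last exact: ex_K_width.
  by apply: ex_K_compact => //; exact: ltW.
split => // beta0 b1 sard; rewrite leNgt; apply/negP => bd.
(* Any [q] strictly between [beta0] and the threshold works: for the compact set of the first part,
   the assumed Sard property contradicts the positive measure. *)
pose q := (beta0 + powR (d.-1)%:R (d%:R)^-1) / 2.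
have bq : beta0 < q by rewrite /q; lra.
have qd : q < powR (d.-1)%:R (d%:R)^-1 by rewrite /q; lra.
have [H [f [fP [fK [r r0]]]]] := part1 q (lt_trans b1 bq) qd.
have [Kc Kw] := fK r r0.
by rewrite (sard H _ q f Kc bq Kw fP) ltxx.
Qed.
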